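(* Let $\nabla L\nabla L^\top$ be invertible (at every point of $\mathbb R^m$) and $[\nabla L\nabla L^\top]^{-1}\in\mathbf C_b^1$. Let $q$ be the order of the quadrature formula $(c_i,b_i)_{i=1}^{M}$. Assume that $q\geq2$ and that $f$, $g_r$ $(r=1,\ldots,D)$ and $\nabla L$ belong to $\mathbf C_b^{q+1}$. Let $\{y_n\}_{n=0}^N$ be the numerical discretization produced by the modified averaged vector field method with numerical integration by $(c_i,b_i)_{i=1}^M$ with stepsize $h=T/N$. Then $$\left[E|L(y_N)-L(y_0)|^2\right]^{1/2}=\begin{cases}\mathcal O(h^{\frac q2}),&\text{if $q$ is even},\\ \mathcal O(h^{\frac{q-1}2}),&\text{if $q$ is odd}.\end{cases}$$
   Context: **SDE.** Consider the autonomous $m$-dimensional Stratonovich SDE $$\mathrm dY(t)=f(Y(t))\,\mathrm dt+\sum_{r=1}^D g_r(Y(t))\circ \mathrm dW_r(t),\quad 0\le t\le T,\quad Y(0)=Y_0,$$ where $W_1,\ldots,W_D$ are independent one-dimensional Brownian motions on a complete filtered probability space $(\Omega,\mathcal F,\{\mathcal F_t\},P)$ satisfying the usual conditions, $Y_0$ is $\mathcal F_0$-measurable with $E|Y_0|^2<\infty$, and the SDE has a unique global solution. Standing assumption: the drift and diffusion coefficients of the equivalent Itô equation, $f+\frac12\sum_{r=1}^D g_r'g_r$ and $g_r$, are globally Lipschitz. **Invariant.** $L=(L^1,\ldots,L^\nu)^\top:\mathbb R^m\to\mathbb R^\nu$ with $L^i\in \mathbf C^1(\mathbb R^m,\mathbb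 R)$ is an invariant: $\nabla L(y)f(y)=\nabla L(y)g_r(y)=0$ for all $r$ and all $y\in\mathbb R^m$, where $\nabla L$ is the $\nu\times m$ Jacobian matrix. **Function spaces.** $\mathbf C_b^k$ is the space of $k$ times continuously differentiable functions with uniformly bounded derivatives up to order $k$. **Quadrature.** A quadrature formula $(c_i,b_i)_{i=1}^M$ on $[0,1]$ approximates $\int_0^1\varphi(x)\,dx$ by $\sum_{i=1}^M b_i\varphi(c_i)$; it has order $q$ if $\int_0^1x^k\,dx=\sum_{i=1}^M b_ic_i^k$ for $k=0,1,\ldots,q-1$. **Discretization.** Let $t_n=nh$, $n=0,\ldots,N$, $Nh=T$. Write $W_r(t_{n+1})-W_r(t_n)=\sqrt h\,\xi_{r,n}$ with $\xi_{r,n}$ independent $N(0,1)$, and let $\Delta\widehat W_{r,n}=\sqrt h\,\zeta_{r,n}$, where $\zeta_{r,n}=\xi_{r,n}$ if $|\xi_{r,n}|\le A_h$, $\zeta_{r,n}=A_h$ if $\xi_{r,n}>A_h$, $\zeta_{r,n}=-A_h$ if $\xi_{r,n}<-A_h$, with $A_h=\sqrt{4|\ln h|}$. Put $y_0=Y_0$, and for $n=0,\ldots,N-1$ let $y_{n+1}=\widetilde Y_{t_n,y_n}(t_{n+1})$, together with $\mathbb R^\nu$-valued random variables $\alpha_0,\ldots,\alpha_D$ (depending on $n$), be the solution (for $h$ sufficiently small) of $$y_{n+1}=y_n+h\Big[\sum_{i=1}^M b_if(\sigma_n(c_i))-\Lambda_n^\top\alpha_0\Big]+\sum_{r=1}^D\Delta\widehat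 W_{r,n}\Big[\sum_{i=1}^M b_ig_r(\sigma_n(c_i))-\Lambda_n^\top\alpha_r\Big],$$ $$\Lambda_n\Lambda_n^\top\alpha_0=\Lambda_n\sum_{i=1}^M b_if(\sigma_n(c_i)),\qquad \Lambda_n\Lambda_n^\top\alpha_r=\Lambda_n\sum_{i=1}^M b_ig_r(\sigma_n(c_i)),\quad r=1,\ldots,D,$$ where $\sigma_n(\tau)=y_n+\tau(y_{n+1}-y_n)$ and $\Lambda_n=\sum_{i=1}^M b_i\nabla L(\sigma_n(c_i))$. $\mathcal O(h^s)$ means bounded by $Kh^s$ for all sufficiently small $h$ with $K$ independent of $h$. *)

(* Defs.v *)
From HB Require Import structures.
From mathcomp Require Import all_boot all_order all_algebra.
From mathcomp Require Import all_classical all_reals all_analysis.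

Set Implicit Arguments.
Unset Strict Implicit.
Unset Printing Implicit Defensive.

Import Order.TTheory GRing.Theory Num.Theory.
Import numFieldNormedType.Exports.

Local Open Scope classical_set_scope.
Local Open Scope ring_scope.

Section calculus.
Context {R : realType}.

Definition enorm {n : nat} (v : 'cV[R]_n) : R :=
  Num.sqrt (\sum_(i < n) v i 0 ^+ 2).

(* [phi] is [k] times differentiable and all its (iterated directional)
   derivatives of orders 0, ..., k, hence [phi] itself too, belong to [A]. *)
Fixpoint derivatives_in {U V : normedModType R} (A : set (U -> V)) (k : nat)
    (phi : U -> V) : Prop :=
  A phi /\
  if k is k'.+1 then
    (forall x, differentiable phi x) /\
    (forall v, derivatives_in A k' (fun x => 'D_v phi x))
  else True.

Definition Ck {U V : normedModType R} (k : nat) (phi : U -> V) : Prop :=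
  derivatives_in [set psi | continuous psi] k phi.

Definition Ckb {U V : normedModType R} (k : nat) (phi : U -> V) : Prop :=
  derivatives_in [set psi | continuous psi /\ bounded_fun psi] k phi.

(* The library's ['J] is for functions of row vectors and is the transpose
   of the usual Jacobian matrix. *)
Definition jac {m n : nat} (F : 'cV[R]_m -> 'cV[R]_n) (y : 'cV[R]_m) :
    'M[R]_(n, m) :=
  \matrix_(i < n, j < m) ('D_(delta_mx j 0) F y) i 0.

Definition is_invariant {m nu D : nat} (L : 'cV[R]_m -> 'cV[R]_nu)
    (f : 'cV[R]_m -> 'cV[R]_m) (g : 'I_D -> 'cV[R]_m -> 'cV[R]_m) : Prop :=
  forall y, jac L y *m f y = 0 /\ forall r, jac L y *m g r y = 0.

Definition ito_drift {m D : nat} (f : 'cV[R]_m -> 'cV[R]_m)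
    (g : 'I_D -> 'cV[R]_m -> 'cV[R]_m) (y : 'cV[R]_m) : 'cV[R]_m :=
  f y + 2^-1 *: \sum_(r < D) jac (g r) y *m g r y.

Definition quadrature_order {M : nat} (c b : 'I_M -> R) (q : nat) : Prop :=
  forall k : nat, (k < q)%N ->
    \int[lebesgue_measure]_(x in `[0 : R, 1]) x ^+ k =
    \sum_(i < M) b i * c i ^+ k.

Definition quadrature {M : nat} {V : lmodType R} (c b : 'I_M -> R)
    (phi : R -> V) : V :=
  \sum_(i < M) b i *: phi (c i).

End calculus.

Section probability_setting.
Context {d : measure_display} {Omega : measurableType d} {R : realType}.
Variable P : probability Omega R.

Definition vec_measurable {n : nat} (G : set (set Omega))
    (X : Omega -> 'cV[R]_n) : Prop :=
  forall (i : 'I_n) (B : set R), measurable B -> G [set w | B (X w i 0)].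

Definition random_vector {n : nat} (X : Omega -> 'cV[R]_n) : Prop :=
  vec_measurable measurable X.

(* A filtration indexed by [0, T] that satisfies the usual conditions.  That
   [F 0] contains all the negligible sets entails that P is complete. *)
Definition usual_filtration (T : R) (F : R -> set (set Omega)) : Prop :=
  [/\ forall t : R, 0 <= t <= T ->
        sigma_algebra [set: Omega] (F t) /\ F t `<=` measurable,
      forall s t : R, 0 <= s -> s <= t -> t <= T -> F s `<=` F t,
      forall A, P.-negligible A -> F 0 A &
      forall t : R, 0 <= t < T ->
        \bigcap_(s in [set s | t < s <= T]) F s `<=` F t].

Definition adapted (T : R) (F : R -> set (set Omega)) (X : R -> Omega -> R) :
    Prop :=
  forall t : R, 0 <= t <= T -> forall B : set R, measurable B -> F t (X t @^-1` B).

(* Independent Brownian motions with respect to [F]: the increments over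
   ]s, t] of W_1, ..., W_D are independent of one another and of [F s]. *)
Definition brownian_motions {D : nat} (T : R) (F : R -> set (set Omega))
    (W : 'I_D -> R -> Omega -> R) : Prop :=
  [/\ forall r, adapted T F (W r),
      forall r, {ae P, forall w, W r 0 w = 0 /\
                  {within `[0, T], continuous (fun t => W r t w)}},
      forall (r : 'I_D) (s t : R), 0 <= s -> s < t -> t <= T ->
        forall B : set R, measurable B ->
          P [set w | B (W r t w - W r s w)] =
          normal_prob 0 (Num.sqrt (t - s)) B &
      forall s t : R, 0 <= s -> s < t -> t <= T ->
        forall (A : set Omega) (B : 'I_D -> set R),
          F s A -> (forall r, measurable (B r)) ->
          P (A `&` \bigcap_r [set w | B r (W r t w - W r s w)]) =
          (P A * \prod_(r < D) P [set w | B r (W r t w - W r s w)%R])%E].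

Definition cvg_in_probability (X : nat -> Omega -> R) (Z : Omega -> R) :
    Prop :=
  forall e : R, 0 < e ->
    P [set w | e <= `|X k w - Z w|] @[k --> \oo] --> 0%E.

Definition node (t : R) (k j : nat) : R := t * (j%:R / k.+1%:R).

Definition ito_sum (X W : R -> Omega -> R) (t : R) (k : nat) (w : Omega) : R :=
  \sum_(j < k.+1) X (node t k j) w * (W (node t k j.+1) w - W (node t k j) w).

Definition covariation_sum (X W : R -> Omega -> R) (t : R) (k : nat)
    (w : Omega) : R :=
  \sum_(j < k.+1) (X (node t k j.+1) w - X (node t k j) w) *
                  (W (node t k j.+1) w - W (node t k j) w).

(* S is the Stratonovich integral of X against W, that is, the sum of the Ito
   integral I of X and of half the covariation C of X and W.  C has to be of
   bounded variation, as it is when X is a semimartingale. *)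
Definition stratonovich_integral (T : R) (F : R -> set (set Omega))
    (X W S : R -> Omega -> R) : Prop :=
  exists I C : R -> Omega -> R,
    [/\ adapted T F I /\ adapted T F C,
        forall t : R, 0 <= t <= T -> cvg_in_probability (ito_sum X W t) (I t),
        forall t : R, 0 <= t <= T ->
          cvg_in_probability (covariation_sum X W t) (C t),
        {ae P, forall w, bounded_variation 0 T (fun t => C t w)} &
        forall t : R, 0 <= t <= T ->
          {ae P, forall w, S t w = I t w + 2^-1 * C t w}].

Definition stratonovich_solution {m D : nat} (T : R) (F : R -> set (set Omega))
    (W : 'I_D -> R -> Omega -> R) (f : 'cV[R]_m -> 'cV[R]_m)
    (g : 'I_D -> 'cV[R]_m -> 'cV[R]_m) (Y0 : Omega -> 'cV[R]_m)
    (Y : R -> Omega -> 'cV[R]_m) : Prop :=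
  [/\ forall i, adapted T F (fun t w => Y t w i 0),
      {ae P, forall w, {within `[0, T], continuous (fun t => Y t w)}} &
      exists S : 'I_D -> 'I_m -> R -> Omega -> R,
        (forall r i, stratonovich_integral T F
           (fun t w => g r (Y t w) i 0) (W r) (S r i)) /\
        forall t : R, 0 <= t <= T -> {ae P, forall w, forall i,
          Y t w i 0 = Y0 w i 0
            + (\int[lebesgue_measure]_(s in `[0, t]) f (Y s w) i 0)
            + \sum_(r < D) S r i t w}].

Definition has_unique_solution {m D : nat} (T : R) (F : R -> set (set Omega))
    (W : 'I_D -> R -> Omega -> R) (f : 'cV[R]_m -> 'cV[R]_m)
    (g : 'I_D -> 'cV[R]_m -> 'cV[R]_m) (Y0 : Omega -> 'cV[R]_m) : Prop :=
  exists Y, stratonovich_solution T F W f g Y0 Y /\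
    forall Y', stratonovich_solution T F W f g Y0 Y' ->
      {ae P, forall w, forall t : R, 0 <= t <= T -> Y t w = Y' t w}.

Definition truncate (A x : R) : R :=
  if `|x| <= A then x else if A < x then A else - A.

Definition truncated_increment {D : nat} (W : 'I_D -> R -> Omega -> R) (h : R)
    (r : 'I_D) (n : nat) (w : Omega) : R :=
  let xi := (W r (n.+1%:R * h) w - W r (n%:R * h) w) / Num.sqrt h in
  Num.sqrt h * truncate (Num.sqrt (4 * `|ln h|)) xi.

(* [y 0], ..., [y N] solve the modified averaged vector field scheme with
   stepsize [h].  As Lambda *m Lambda^T is not required to be invertible along
   the solution, alpha need not be determined by y when h is large. *)
Definition mavf_scheme {m nu D M : nat} (L : 'cV[R]_m -> 'cV[R]_nu)
    (f : 'cV[R]_m -> 'cV[R]_m) (g : 'I_D -> 'cV[R]_m -> 'cV[R]_m)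
    (c b : 'I_M -> R) (W : 'I_D -> R -> Omega -> R) (Y0 : Omega -> 'cV[R]_m)
    (h : R) (N : nat) (y : nat -> Omega -> 'cV[R]_m) : Prop :=
  [/\ y 0%N = Y0,
      forall n, (n <= N)%N -> random_vector (y n) &
      forall n, (n < N)%N ->
        exists (alpha0 : Omega -> 'cV[R]_nu) (alpha : 'I_D -> Omega -> 'cV[R]_nu),
          [/\ random_vector alpha0,
              forall r, random_vector (alpha r) &
              {ae P, forall w,
                let sigma tau := y n w + tau *: (y n.+1 w - y n w) in
                let fbar := quadrature c b (fun tau => f (sigma tau)) in
                let gbar r := quadrature c b (fun tau => g r (sigma tau)) in
                let Lambda := quadrature c b (fun tau => jac L (sigma tau)) in
                [/\ y n.+1 w = y n w
                      + h *: (fbar - Lambda^T *m alpha0 w)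
                      + \sum_(r < D) truncated_increment W h r n w *:
                          (gbar r - Lambda^T *m alpha r w),
                    Lambda *m Lambda^T *m alpha0 w = Lambda *m fbar &
                    forall r,
                      Lambda *m Lambda^T *m alpha r w = Lambda *m gbar r]}]].

End probability_setting.

(* Main.v *)
Require Import Defs.
From HB Require Import structures.
From mathcomp Require Import all_boot all_order all_algebra.
From mathcomp Require Import all_classical all_reals all_analysis measurable_realfun.
From mathcomp Require Import ring lra.

Set Implicit Arguments.
Unset Strict Implicit.
Unset Printing Implicit Defensive.

Import Order.TTheory GRing.Theory Num.Theory.
Import numFieldNormedType.Exports.

Local Open Scope classical_set_scope.
Local Open Scope ring_scope.

(* Since Lambda (y_(n+1) - y_n) = 0, one step changes each component l of the
   invariant exactly by the error of the quadrature formula on the integral of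
   the derivative of l along the segment [y_n, y_(n+1)].  By Taylor expansion
   this error is kappa D_u^(q+1) l (y_n) + O(|u|^(q+2)) with u = y_(n+1) - y_n.
   The projection in the scheme never increases norms, and it is O(|u|) on the
   fields tangent to the level sets of l, so u = v + O(h + |dW|^2) with
   v = sum_r dW_r g_r(y_n).  For odd q, the bound |u|^(q+1) on each step is
   enough.  For even q, D_v^(q+1) l (y_n) is odd in the truncated increments,
   hence uncorrelated with the past, and only its mean square accumulates; the
   remainder is of size h^((q+2)/2) per step.  That y_n is adapted is not assumed
   but follows from the implicit step having at most one solution when h is
   small. *)

(** * Mean value theorem and Taylor bounds *)

Section mean_value_and_taylor.
Context {R : realType}.

(** Truncation makes the analysis of one step deterministic: the increments fed to the scheme are at
    most [sqrt h * sqrt (4 |ln h|)], which tends to 0, so for small [h] every outcome lies in the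
    range where the averaged Gram matrix stays invertible and the implicit equation determines its
    solution. The constants do not depend on the state, so they hold along the whole path.

    The obstacle is that the increment [u] is an implicit function of the noise, hence not odd in
    it. This is why the derivative is taken in the explicit direction [v], at a price of the same
    order as the Taylor remainder.

    The orders balance as follows. A step has size [sqrt h]. For even [q], [1/h] uncorrelated terms
    of mean square [h^(q+1)] give [h^q], and adding up [1/h] remainders without any cancellation
    gives mean square [h^q] as well. For odd [q], adding [1/h] terms of size [h^((q+1)/2)] gives
    [h^((q-1)/2)]. Both parities run through one recursion with a single exponent [e]. *)

Lemma mean_value (f df : R -> R) (a b : R) :
  (forall x : R, is_derive x 1 f (df x)) ->
  exists2 c, `|c - a| <= `|b - a| & f b - f a = df c * (b - a).
Proof.
move=> fd.
have fc : continuous f.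
  by move=> x; apply/differentiable_continuous/derivable1_diffP; case: (fd x).
have [ab|/ltW ba] := leP a b.
  have [|c + fE] := @MVT_segment R f df a b ab (fun x _ => fd x).
    exact: continuous_subspaceT.
  rewrite in_itv/= => /andP[ac cb]; exists c => //.
  by rewrite !ger0_norm ?subr_ge0// lerB.
have [|c + fE] := @MVT_segment R f df b a ba (fun x _ => fd x).
  exact: continuous_subspaceT.
rewrite in_itv/= => /andP[ac cb]; exists c; last first.
  by rewrite -opprB fE -mulrN opprB.
by rewrite !ler0_norm ?subr_le0// lerN2 lerB.
Qed.

(** Induction on [n]: the remainder vanishes at 0 and its derivative is the remainder of the shifted
    family [G k.+1], so each mean value step gains one factor [|t|]. The factor [1/n!] is given up,
    since only the order in [t] matters later. *)
Lemma taylor_bound (n : nat) (G : nat -> R -> R) (B : R) :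
  (forall k (t : R), (k < n)%N -> is_derive t 1 (G k) (G k.+1 t)) ->
  (forall t, `|G n t| <= B) ->
  forall t, `|G 0%N t - \sum_(k < n) G k 0 * (t ^+ k / k`!%:R)| <= B * `|t| ^+ n.
Proof.
elim: n G => [G _ GB t|n IH G GD GB t].
  by rewrite big_ord0 subr0 expr0 mulr1.
pose e s := G 0%N s - \sum_(k < n.+1) G k 0 * (s ^+ k / k`!%:R).
pose de s := G 1%N s - \sum_(k < n) G k.+1 0 * (s ^+ k / k`!%:R).
have ed (x : R) : is_derive x 1 e (de x).
  rewrite /e /de.
  have -> : (fun s => G 0%N s - \sum_(k < n.+1) G k 0 * (s ^+ k / k`!%:R)) =
      G 0%N - \sum_(k < n.+1) (fun s : R => G k 0 * (s ^+ k / k`!%:R)).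
    by apply/funext => s; rewrite fctE fct_sumE.
  apply: is_deriveB.
    exact: GD.
  rewrite -[X in is_derive _ _ _ X]add0r.
  rewrite big_ord_recl -[\sum_(k < n) G k.+1 0 * _]add0r.
  apply: is_deriveD.
    have -> : (fun s : R => G (@ord0 n) 0 * (s ^+ @ord0 n / (@ord0 n)`!%:R)) =
        cst (G 0%N 0) by apply/funext => s; rewrite /= expr0 fact0 divr1 mulr1.
    exact: is_derive_cst.
  rewrite ?add0r; apply: is_derive_sum => i.
  have -> : (fun s : R => G (lift ord0 i) 0 *
      (s ^+ lift ord0 i / (lift ord0 i)`!%:R)) =
      (G i.+1 0 / i.+1`!%:R) *: (id ^+ i.+1 : R -> R).
    by apply/funext => s; rewrite fctE /= /GRing.scale /= mulrA mulrAC.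
  apply: is_derive_eq.
  rewrite /= /GRing.scale /= mulr1 factS natrM invfM; field.
  by rewrite nat1r !pnatr_eq0 -lt0n fact_gt0.
have e0 : e 0 = 0.
  rewrite /e big_ord_recl /= expr0 fact0 divr1 mulr1 big1 ?addr0 ?subrr// => i _.
  by rewrite expr0n /= mul0r mulr0.
have [c ct etE] := mean_value 0 t ed.
rewrite -/(e t).
move: etE; rewrite e0 !subr0 => ->; rewrite normrM exprSr mulrA.
apply: ler_wpM2r => //.
apply: (le_trans (IH (fun k => G k.+1) _ _ c)) => //.
  by move=> k s kn; apply: GD.
have B0 : 0 <= B by apply: le_trans (GB 0).
rewrite ler_wpM2l// lerXn2r ?nnegrE//.
by move: ct; rewrite !subr0.
Qed.

End mean_value_and_taylor.

(** * Iterated directional derivatives of C_b^k functions *)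

Section directional_powers.
Context {R : realType} {m : nat}.
Implicit Types (phi : 'cV[R]_m -> R) (u y : 'cV[R]_m).

Lemma Ckb_bounded (V : normedModType R) k (phi : 'cV[R]_m -> V) :
  Ckb k phi -> exists2 C, 0 <= C & forall x, `|phi x| <= C.
Proof.
have bd : bounded_fun phi -> exists2 C, 0 <= C & forall x, `|phi x| <= C.
  move=> [B [_ HB]]; exists (`|B| + 1) => [|x].
    by rewrite addr_ge0.
  apply: HB => //=.
  by apply: le_lt_trans (ler_norm _) _; rewrite ltrDl.
by case: k => [|k]; rewrite /Ckb /= => -[[_ /bd]].
Qed.

Lemma Ckb_differentiable (V : normedModType R) k (phi : 'cV[R]_m -> V) :
  Ckb k.+1 phi -> forall x, differentiable phi x.
Proof. by rewrite /Ckb/= => -[_ []]. Qed.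

Lemma Ckb_derive (V : normedModType R) k (phi : 'cV[R]_m -> V) :
  Ckb k.+1 phi -> forall v, Ckb k (fun x => 'D_v phi x).
Proof. by rewrite /Ckb/= => -[_ []]. Qed.

Lemma Ckb_pred (V : normedModType R) k (phi : 'cV[R]_m -> V) :
  Ckb k.+1 phi -> Ckb k phi.
Proof.
elim: k phi => [phi [] //|k IH phi [Aphi [Dphi Cphi]]].
by split=> //; split => // v; apply: IH.
Qed.

Lemma Ckb_le (V : normedModType R) j k (phi : 'cV[R]_m -> V) :
  (j <= k)%N -> Ckb k phi -> Ckb j phi.
Proof.
move=> /subnK <-; elim: (k - j)%N => [//|i IH] /Ckb_pred; exact: IH.
Qed.

Lemma derive_coord (a b : nat) (phi : 'cV[R]_m -> 'M[R]_(a, b)) i j x v :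
  differentiable phi x -> 'D_v (fun y => phi y i j) x = 'D_v phi x i j.
Proof.
move=> dphi; rewrite derive_mx ?mxE//.
exact: diff_derivable.
Qed.

Lemma differentiable_coord_comp (a b : nat) (phi : 'cV[R]_m -> 'M[R]_(a, b)) i j x :
  differentiable phi x -> differentiable (fun y => phi y i j) x.
Proof.
move=> dphi; apply: (@differentiable_comp _ _ _ _ phi (fun A => A i j)) => //.
exact: differentiable_coord.
Qed.

Lemma norm_coord_le (a b : nat) (A : 'M[R]_(a, b)) i j : `|A i j| <= `|A|.
Proof.
rewrite -[`|A|]/(mx_norm A) mx_normrE; exact: (le_bigmax _ (fun i => `|A i.1 i.2|) (i, j)).
Qed.

Lemma mx_norm_le (a b : nat) (A : 'M[R]_(a, b)) (C : R) :
  0 <= C -> (forall i j, `|A i j| <= C) -> `|A| <= C.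
Proof.
move=> C0 AC; rewrite -[`|A|]/(mx_norm A) mx_normrE.
by apply: bigmax_le => // -[].
Qed.

Lemma Ckb_coord k (a b : nat) (phi : 'cV[R]_m -> 'M[R]_(a, b)) i j :
  Ckb k phi -> Ckb k (fun y => phi y i j).
Proof.
have base k' (psi : 'cV[R]_m -> 'M[R]_(a, b)) : Ckb k' psi ->
    continuous (fun y => psi y i j : R) /\ bounded_fun (fun y => psi y i j).
  move=> psik'; have [C C0 HC] := Ckb_bounded psik'.
  have cpsi : continuous psi by case: k' psik' => [|k'] [[]].
  split=> [x|].
    apply: (@continuous_comp _ _ _ psi (fun A => A i j)); first exact: cpsi.
    exact: coord_continuous.
  exists C; split; first by rewrite ger0_real.
  by move=> B CB x _ /=; rewrite (le_trans (norm_coord_le _ _ _))// (le_trans (HC _))// ltW.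
elim: k phi => [|k IH] phi phik; first by split => //; exact: base phik.
have dphi := Ckb_differentiable phik.
split; last split.
- exact: base phik.
- by move=> x; exact: differentiable_coord_comp.
- move=> v; rewrite (_ : (fun x => _) = fun x => 'D_v phi x i j); last first.
    by apply/funext => x; rewrite derive_coord.
  by apply: IH; exact: Ckb_derive.
Qed.

(* [dpow j phi u y] is the [j]-fold derivative of [phi] at [y] in the direction
   [u], as a form of degree [j] in [u] whose coefficients are the partial
   derivatives of [phi]. *)
Fixpoint dpow (j : nat) phi u y : R :=
  if j is j'.+1 then
    \sum_(i < m) u i 0 * dpow j' (fun x => 'D_(delta_mx i 0) phi x) u y
  else phi y.

Lemma derive_basis phi u y : differentiable phi y ->
  'D_u phi y = \sum_(i < m) u i 0 * 'D_(delta_mx i 0) phi y.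
Proof.
move=> dphi; rewrite deriveE// [in LHS](matrix_sum_delta u) linear_sum/=.
apply: eq_bigr => i _; rewrite big_ord1 linearZ/= deriveE// ord1.
Qed.

Lemma is_derive_line phi u y (t : R) :
  (forall x, differentiable phi x) ->
  is_derive t 1 (fun s : R => phi (y + s *: u)) (dpow 1 phi u (y + t *: u)).
Proof.
move=> dphi /=.
rewrite -(derive_basis u (dphi _)).
have h : differentiable (fun s : R => y + s *: u) t by [].
have -> : (fun s : R => phi (y + s *: u)) = phi \o (fun s : R => y + s *: u) by [].
apply: DeriveDef.
  apply: diff_derivable; exact: differentiable_comp.
rewrite deriveE; last exact: differentiable_comp.
rewrite diff_comp//= deriveE//; congr ('d _ _ _).
have -> : (fun s : R => y + s *: u) = cst y + *:%R^~ u by [].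
have dscale : differentiable ( *:%R^~ u : R -> _) t by [].
have dscaleE : 'd ( *:%R^~ u : R -> _) t = *:%R^~ u :> (R -> _) by exact: diff_val.
rewrite -deriveE// deriveD; [|exact: derivable_cst|exact: diff_derivable].
by rewrite derive_cst add0r deriveE// dscaleE scale1r.
Qed.

Local Notation partial phi i := (fun x => 'D_(delta_mx i 0) phi x).

(** The hypothesis concerns the partial derivatives only: a component of the invariant has bounded
    derivatives but may itself be unbounded, hence outside [Ckb]. [dpowS_bound] and
    [dpowS_lipschitz] have the same form for this reason. *)
Lemma is_derive_dpowS j phi u y (t : R) :
  (forall i, is_derive t 1 (fun s : R => dpow j (partial phi i) u (y + s *: u))
     (dpow j.+1 (partial phi i) u (y + t *: u))) ->
  is_derive t 1 (fun s : R => dpow j.+1 phi u (y + s *: u))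
    (dpow j.+2 phi u (y + t *: u)).
Proof.
move=> phiP; have -> : (fun s : R => dpow j.+1 phi u (y + s *: u)) =
    \sum_(i < m) (u i 0 *: (fun s : R => dpow j (partial phi i) u (y + s *: u))).
  by apply/funext => s; rewrite fct_sumE.
by apply: is_derive_sum => i; exact: is_deriveZ.
Qed.

Lemma is_derive_dpow j phi u y (t : R) : Ckb j.+1 phi ->
  is_derive t 1 (fun s : R => dpow j phi u (y + s *: u))
    (dpow j.+1 phi u (y + t *: u)).
Proof.
elim: j phi => [|j IH] phi phij.
  by apply: is_derive_line; exact: Ckb_differentiable phij.
by apply: is_derive_dpowS => i; apply: IH; exact: Ckb_derive.
Qed.

Lemma dpowN j phi u y : dpow j phi (- u) y = (-1) ^+ j * dpow j phi u y.
Proof.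
elim: j phi => [|j IH] phi; first by rewrite mul1r.
rewrite /= mulr_sumr; apply: eq_bigr => i _; rewrite IH mxE exprS.
by rewrite mulrCA !mulNr mul1r mulrN.
Qed.

Lemma dpowS_bound j phi :
  (forall i, exists2 C, 0 <= C &
     forall u y, `|dpow j (partial phi i) u y| <= C * `|u| ^+ j) ->
  exists2 C, 0 <= C & forall u y, `|dpow j.+1 phi u y| <= C * `|u| ^+ j.+1.
Proof.
move=> bphi.
have /choice[C HC] : forall i : 'I_m, exists C, 0 <= C /\ forall u y,
    `|dpow j (partial phi i) u y| <= C * `|u| ^+ j.
  by move=> i; have [C C0 HC] := bphi i; exists C.
exists (\sum_i C i) => [|u y]; first by apply: sumr_ge0 => i _; case: (HC i).
rewrite (le_trans (ler_norm_sum _ _ _))// mulr_suml ler_sum// => i _.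
rewrite normrM exprS mulrCA ler_pM//; first exact: norm_coord_le.
exact: (HC i).2.
Qed.

Lemma dpow_bound j phi : Ckb j phi ->
  exists2 C, 0 <= C & forall u y, `|dpow j phi u y| <= C * `|u| ^+ j.
Proof.
elim: j phi => [|j IH] phi phij.
  by have [C C0 HC] := Ckb_bounded phij; exists C => // u y; rewrite mulr1.
by apply: dpowS_bound => i; apply: IH; exact: Ckb_derive.
Qed.

Lemma line_lipschitz phi (B : R) u y :
  (forall x, differentiable phi x) ->
  (forall x, `|dpow 1 phi u x| <= B) ->
  `|phi (y + u) - phi y| <= B.
Proof.
move=> dphi HB.
have [c _ ] := mean_value 0 1 (fun t : R => is_derive_line u y t dphi).
by rewrite scale1r scale0r addr0 subr0 mulr1 => ->.
Qed.

Lemma Ckb_lipschitz phi : Ckb 1 phi ->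
  exists2 C, 0 <= C & forall x y, `|phi x - phi y| <= C * `|x - y|.
Proof.
move=> phi1; have [C C0 HC] := dpow_bound phi1.
exists C => // x y; rewrite -[in phi x](subrK y x) [x - y + y]addrC.
apply: line_lipschitz (Ckb_differentiable phi1) _ => z.
by have := HC (x - y) z; rewrite expr1.
Qed.

(* Multiplying by [rho] avoids the exponent [j - 1] of the estimate
   [C rho^(j-1) (rho |y - y'| + |u - u'|)]. *)
Definition dpow_lipschitz_with j phi (C : R) := forall (rho : R) u u' y y',
  `|u| <= rho -> `|u'| <= rho ->
  rho * `|dpow j phi u y - dpow j phi u' y'| <=
  C * rho ^+ j * (rho * `|y - y'| + `|u - u'|).

Lemma dpowS_lipschitz j phi :
  (forall i, exists2 C, 0 <= C &
     forall u y, `|dpow j (partial phi i) u y| <= C * `|u| ^+ j) ->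
  (forall i, exists2 C, 0 <= C & dpow_lipschitz_with j (partial phi i) C) ->
  exists2 C, 0 <= C & dpow_lipschitz_with j.+1 phi C.
Proof.
move=> bphi lphi.
have /choice[C1 HC1] : forall i : 'I_m, exists C, 0 <= C /\ forall u y,
    `|dpow j (partial phi i) u y| <= C * `|u| ^+ j.
  by move=> i; have [C C0 HC] := bphi i; exists C.
have /choice[C2 HC2] : forall i : 'I_m, exists C, 0 <= C /\
    dpow_lipschitz_with j (partial phi i) C.
  by move=> i; have [C C0 HC] := lphi i; exists C.
exists (\sum_i (C1 i + C2 i)) => [|rho u u' y y' ur u'r].
  by apply: sumr_ge0 => i _; case: (HC1 i); case: (HC2 i) => *; rewrite addr_ge0.
have rho0 : 0 <= rho by apply: le_trans ur.
rewrite /= -sumrB.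
rewrite (le_trans (ler_wpM2l rho0 (ler_norm_sum _ _ _)))// mulr_sumr !mulr_suml.
apply: ler_sum => i _.
set a := dpow _ _ _ _; set a' := dpow _ _ _ _.
have -> : u i 0 * a - u' i 0 * a' = (u i 0 - u' i 0) * a + u' i 0 * (a - a') by ring.
have [C10 Ha] := HC1 i; have [C20 Haa'] := HC2 i.
have {}Ha : `|a| <= C1 i * rho ^+ j.
  by rewrite (le_trans (Ha _ _))// ler_wpM2l// lerXn2r// nnegrE.
have {}Haa' := Haa' rho u u' y y' ur u'r.
have uu' : `|u i 0 - u' i 0| <= `|u - u'|.
  by have := norm_coord_le (u - u') i 0; rewrite !mxE.
have u'i : `|u' i 0| <= rho by apply: le_trans (norm_coord_le _ _ _) u'r.
have H1 : `|(u i 0 - u' i 0) * a| <= `|u - u'| * (C1 i * rho ^+ j).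
  by rewrite normrM ler_pM.
have H2 : rho * `|u' i 0 * (a - a')| <=
    rho * (C2 i * rho ^+ j * (rho * `|y - y'| + `|u - u'|)).
  rewrite normrM mulrCA; apply: ler_pM => //; first by rewrite mulr_ge0.
apply: (le_trans (ler_wpM2l rho0 (ler_normD _ _))); rewrite mulrDr.
apply: (le_trans (lerD (ler_wpM2l rho0 H1) H2)).
rewrite exprS.
(* The claimed bound multiplies [C1 i] by the whole bracket, while the first product only uses the
   part [|u - u'|]; the rest is this nonnegative surplus. *)
have : 0 <= C1 i * (rho * rho ^+ j) * (rho * `|y - y'|).
  by rewrite !mulr_ge0// exprn_ge0.
by lra.
Qed.

Lemma dpow_lipschitz j phi : Ckb j.+1 phi ->
  exists2 C, 0 <= C & dpow_lipschitz_with j phi C.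
Proof.
elim: j phi => [|j IH] phi phij.
  have [C C0 HC] := Ckb_lipschitz phij; exists C => // rho u u' y y' ur u'r.
  have rho0 : 0 <= rho by apply: le_trans ur.
  rewrite expr0 mulr1 /= mulrDr.
  apply: (@le_trans _ _ (C * (rho * `|y - y'|))); last by rewrite lerDl mulr_ge0.
  by rewrite mulrCA ler_wpM2l.
apply: dpowS_lipschitz => i; last by apply: IH; exact: Ckb_derive.
by apply: dpow_bound; apply: Ckb_pred; exact: Ckb_derive.
Qed.

End directional_powers.

(** * Local error of the quadrature formula *)

Section local_error.
Context {R : realType} {m : nat}.

Lemma Ckb_lipschitz_mx (a b : nat) (phi : 'cV[R]_m -> 'M[R]_(a, b)) : Ckb 1 phi ->
  exists2 C, 0 <= C & forall x y, `|phi x - phi y| <= C * `|x - y|.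
Proof.
move=> phi1.
have /choice[C HC] : forall ij : 'I_a * 'I_b, exists C, 0 <= C /\
    forall x y, `|phi x ij.1 ij.2 - phi y ij.1 ij.2| <= C * `|x - y|.
  move=> ij; have [C C0 HC] := Ckb_lipschitz (Ckb_coord ij.1 ij.2 phi1).
  by exists C.
have C0 : 0 <= \sum_ij C ij by apply: sumr_ge0 => ij _; case: (HC ij).
exists (\sum_ij C ij) => // x y; apply: mx_norm_le => [|i j].
  by rewrite mulr_ge0.
rewrite !mxE (le_trans ((HC (i, j)).2 x y))// ler_wpM2r//.
rewrite (bigD1 (i, j))//= lerDl; apply: sumr_ge0 => ij _; by case: (HC ij).
Qed.

Lemma Rintegral_expr (k : nat) :
  \int[lebesgue_measure]_(x in `[0 : R, 1]) x ^+ k = k.+1%:R^-1.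
Proof.
have F' : {in `]0%R, 1%R[, derive1 (fun x : R => x ^+ k.+1 / k.+1%:R) =1 (fun x => x ^+ k)}.
  move=> x _; rewrite derive1Mr; last exact: exprn_derivable.
  by rewrite exp_derive1 /GRing.scale /= mulrAC divff ?mul1r.
rewrite /Rintegral (@continuous_FTC2 _ (fun x => x ^+ k)
  (fun x : R => x ^+ k.+1 / k.+1%:R))//=.
- by rewrite expr1n expr0n /= mul0r subr0 div1r.
- by apply: continuous_subspaceT => x; exact: exprn_continuous.
- split => /=.
  + by move=> x _; apply: derivableM; [exact: exprn_derivable|exact: derivable_cst].
  + apply: cvg_at_right_filter; apply: cvgM; last exact: cvg_cst.
    exact: exprn_continuous.
  + apply: cvg_at_left_filter; apply: cvgM; last exact: cvg_cst.
    exact: exprn_continuous.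
Qed.

(* Peano constant: the quadrature error on [x^q], divided by [q!]. *)
Definition error_constant (M q : nat) (c b : 'I_M -> R) : R :=
  q.+1`!%:R^-1 - (\sum_(i < M) b i * c i ^+ q) / q`!%:R.

(** Taylor expansion of [l] at [y + u] and of its derivative at the nodes. The terms of degree at
    most [q] in [u] cancel by exactness on [x ^+ k] for [k < q], and degree [q.+1] leaves the error
    constant. *)
Lemma quadrature_local_error (M q : nat) (c b : 'I_M -> R) (l : 'cV[R]_m -> R) :
  quadrature_order c b q ->
  (forall x, differentiable l x) ->
  (forall i, Ckb q.+1 (fun x => 'D_(delta_mx i 0) l x)) ->
  exists2 C : R, 0 <= C & forall y u,
    `|l (y + u) - l y - \sum_(i < M) b i * dpow 1 l u (y + c i *: u)
       - error_constant q c b * dpow q.+1 l u y| <= C * `|u| ^+ q.+2.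
Proof.
move=> ord dl Cl.
have ltop : exists2 C, 0 <= C & forall u y, `|dpow q.+2 l u y| <= C * `|u| ^+ q.+2.
  by apply: dpowS_bound => i; exact: dpow_bound.
have dl_line u y k (t : R) : (k <= q.+1)%N ->
    is_derive t 1 (fun s : R => dpow k l u (y + s *: u)) (dpow k.+1 l u (y + t *: u)).
  case: k => [_|k kq]; first exact: is_derive_line.
  apply: is_derive_dpowS => i; apply: is_derive_dpow.
  exact: Ckb_le (Cl i).
have [C0 C00 HC0] := ltop.
pose S k := \sum_(i < M) b i * c i ^+ k.
(* The [1] pays for the Taylor remainder at the endpoint, the sum for those at the nodes [c i]. *)
exists (C0 * (1 + \sum_(i < M) `|b i| * `|c i| ^+ q.+1)) => [|y u].
  by rewrite mulr_ge0// addr_ge0// sumr_ge0.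
pose G k (t : R) := dpow k l u (y + t *: u).
pose D k := dpow k l u y.
have G0 k : G k 0 = D k by rewrite /G scale0r addr0.
have D0 : D 0%N = l y by [].
have T1 : `|l (y + u) - \sum_(k < q.+2) D k * (1 ^+ k / k`!%:R)| <= C0 * `|u| ^+ q.+2.
  have := @taylor_bound R q.+2 G (C0 * `|u| ^+ q.+2)
    (fun k t kq => dl_line u y k t kq) (fun t => HC0 u _) 1.
  rewrite normr1 expr1n mulr1; under eq_bigr do rewrite G0.
  by rewrite {1}/G scale1r.
have T2 i : `|dpow 1 l u (y + c i *: u) - \sum_(k < q.+1) D k.+1 * (c i ^+ k / k`!%:R)|
    <= C0 * `|u| ^+ q.+2 * `|c i| ^+ q.+1.
  have := @taylor_bound R q.+1 (fun k => G k.+1) (C0 * `|u| ^+ q.+2)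
    (fun k t kq => dl_line u y k.+1 t kq) (fun t => HC0 u _) (c i).
  by under eq_bigr do rewrite G0.
rewrite -/(D q.+1); move: D D0 T1 T2 {G G0} => D D0.
rewrite big_ord_recl expr0 fact0 divr1 mulr1 D0.
have {D0}-> : \sum_(i < M) b i * dpow 1 l u (y + c i *: u) =
    \sum_(i < M) b i * (dpow 1 l u (y + c i *: u) -
        \sum_(k < q.+1) D k.+1 * (c i ^+ k / k`!%:R)) +
    \sum_(k < q.+1) D k.+1 * (S k / k`!%:R).
  under [in RHS]eq_bigr do rewrite mulrBr.
  rewrite sumrB -addrA -[LHS]addr0; congr (_ + _); apply/esym/eqP.
  rewrite addrC subr_eq0; apply/eqP.
  under [in RHS]eq_bigr do rewrite mulr_sumr.
  rewrite exchange_big /=; apply: eq_bigr => k _.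
  rewrite /S mulr_suml mulr_sumr; apply: eq_bigr => i _; ring.
rewrite /error_constant -/(S q) => T1 T2; set E := _ - _ - _ - _.
(* After the cancellation [E] consists of the Taylor remainders alone. *)
have -> : E = (l (y + u) - (l y + \sum_(k < q.+1) D k.+1 * (1 ^+ k.+1 / k.+1`!%:R)))
   - \sum_(i < M) b i * (dpow 1 l u (y + c i *: u) -
        \sum_(k < q.+1) D k.+1 * (c i ^+ k / k`!%:R)).
  rewrite /E; set Z := \sum_(i < M) _.
  rewrite !big_ord_recr /=.
  have -> : \sum_(k < q) D k.+1 * (1 ^+ k.+1 / k.+1`!%:R) =
      \sum_(k < q) D k.+1 * (S k / k`!%:R).
    apply: eq_bigr => k _.
    by rewrite /S -(ord k)// Rintegral_expr expr1n factS natrM invfM mul1r.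
  by rewrite expr1n; ring.
rewrite (le_trans (ler_normB _ _))// mulrDr mulr1 mulrDl lerD//.
rewrite (le_trans (ler_norm_sum _ _ _))// mulrAC mulr_sumr ler_sum// => i _.
by rewrite normrM mulrCA ler_wpM2l//; exact: T2.
Qed.

End local_error.

(** * Normal equations and perturbed Gram matrices *)

Section matrix_estimates.
Context {R : realType}.

(** The norm is the largest absolute value of an entry, so it is submultiplicative only up to the
    inner dimension; hence the dimension factors in the constants below. *)
Lemma norm_mulmx_le (a k b : nat) (A : 'M[R]_(a, k)) (B : 'M[R]_(k, b)) :
  `|A *m B| <= k%:R * (`|A| * `|B|).
Proof.
apply: mx_norm_le => [|i j]; first by rewrite !mulr_ge0.
rewrite mxE (le_trans (ler_norm_sum _ _ _))//.
rewrite (le_trans (@ler_sum _ _ _ _ _ (fun=> `|A| * `|B|) _))//; last first.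
  by rewrite sumr_const card_ord mulr_natl.
by move=> l _; rewrite normrM ler_pM// norm_coord_le.
Qed.

Lemma norm_trmx (a b : nat) (A : 'M[R]_(a, b)) : `|A^T| = `|A|.
Proof.
suff H (c d : nat) (B : 'M[R]_(c, d)) : `|B^T| <= `|B|.
  by apply/eqP; rewrite eq_le H/= -{1}(trmxK A) H.
by apply: mx_norm_le => // i j; rewrite mxE norm_coord_le.
Qed.

Lemma dotE n (u v : 'cV[R]_n) : (u^T *m v) 0 0 = \sum_i u i 0 * v i 0.
Proof. by rewrite mxE; apply: eq_bigr => i _; rewrite mxE. Qed.

(** With [dot_le], this passes between the maximum norm and the Euclidean inner product, for which
    orthogonality is available. *)
Lemma sqr_norm_le_dot n (u : 'cV[R]_n) : `|u| ^+ 2 <= (u^T *m u) 0 0.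
Proof.
rewrite dotE.
have s0 : 0 <= \sum_i u i 0 * u i 0 by apply: sumr_ge0 => i _; rewrite -expr2 sqr_ge0.
rewrite -[leRHS]sqr_sqrtr// lerXn2r// ?nnegrE ?sqrtr_ge0//.
apply: mx_norm_le => [|i j]; first exact: sqrtr_ge0.
rewrite (ord1 j) -sqrtr_sqr ler_sqrt// (bigD1 i)//= expr2 lerDl.
by apply: sumr_ge0 => k _; rewrite -expr2 sqr_ge0.
Qed.

Lemma dot_le n (u v : 'cV[R]_n) : (u^T *m v) 0 0 <= n%:R * (`|u| * `|v|).
Proof.
by rewrite (le_trans (ler_norm _))// (le_trans (norm_coord_le _ _ _))//
  (le_trans (norm_mulmx_le _ _))// norm_trmx.
Qed.

(* [S^T a] is the orthogonal projection of [v] on the row space of [S]. *)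
Lemma normal_equation_residual_le (nu m : nat) (S : 'M[R]_(nu, m))
    (a : 'cV[R]_nu) (v : 'cV[R]_m) :
  S *m S^T *m a = S *m v -> `|v - S^T *m a| <= m%:R * `|v|.
Proof.
move=> Sa; set p := S^T *m a; set w := v - p.
have pw : p^T *m w = 0.
  by rewrite /p trmx_mul trmxK -mulmxA /w mulmxBr mulmxA Sa subrr mulmx0.
have wp : w^T *m p = 0 by rewrite -[LHS]trmxK trmx_mul trmxK pw trmx0.
(* Pythagoras: the residual is no longer than [v] in Euclidean length. The factor [m] comes from the
   change of norm and [m <= m ^ 2]. *)
have vE : v^T *m v = w^T *m w + p^T *m p.
  have -> : v = w + p by rewrite subrK.
  clearbody w p; rewrite mulmxDr [(w + p)^T]linearD/= !mulmxDl pw wp.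
  by rewrite addr0 add0r.
have p0 : 0 <= (p^T *m p) 0 0 by apply: le_trans (sqr_norm_le_dot _); exact: sqr_ge0.
rewrite -(ler_pXn2r (ltn0Sn 1)) ?nnegrE ?mulr_ge0//.
apply: (le_trans (sqr_norm_le_dot w)).
apply: (@le_trans _ _ ((v^T *m v) 0 0)); first by rewrite vE [leRHS]mxE lerDl.
apply: (le_trans (dot_le _ _)); rewrite exprMn -[_ * `|v|]expr2 ler_wpM2r ?sqr_ge0//.
case: m {S Sa p w pw wp vE p0 v a} => [|m]; first by rewrite expr0n.
by rewrite expr2 ler_peMl// ler1n.
Qed.

(** Invertibility of [G *m G^T] bounds [a] by [G^T *m a]; for [S] close to [G] this survives for
    [S^T *m a] with twice the constant; and the squared length of [S^T *m a] is the inner product of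
    [a] with [S *m S^T *m a]. *)
Lemma perturbed_gram_lower_bound (nu m : nat) (G S : 'M[R]_(nu, m)) (A : 'M[R]_nu)
    (CA CG : R) :
  A *m (G *m G^T) = 1%:M -> `|A| <= CA -> `|G| <= CG ->
  nu%:R * (CA * (m%:R * CG)) * (nu%:R * `|G - S|) <= 2^-1 ->
  forall a : 'cV_nu, `|a| <= 4 * (nu%:R * (CA * (m%:R * CG))) ^+ 2 * nu%:R * `|S *m S^T *m a|.
Proof.
move=> AG HA HG; set C1 := nu%:R * _ => small a.
have CA0 : 0 <= CA by apply: le_trans HA.
have CG0 : 0 <= CG by apply: le_trans HG.
have C10 : 0 <= C1 by rewrite !mulr_ge0.
have H1 : `|a| <= C1 * `|G^T *m a|.
  have aE : A *m (G *m (G^T *m a)) = a by rewrite mulmxA mulmxA -(mulmxA A) AG mul1mx.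
  rewrite -{1}aE (le_trans (norm_mulmx_le _ _))// /C1 -!mulrA ler_wpM2l// ler_pM//.
  by rewrite (le_trans (norm_mulmx_le _ _))// ler_wpM2l// ler_wpM2r.
have H2 : `|G^T *m a| <= `|S^T *m a| + nu%:R * `|G - S| * `|a|.
  have -> : G^T *m a = S^T *m a + (G - S)^T *m a.
    by rewrite -mulmxDl linearB/= addrC subrK.
  rewrite (le_trans (ler_normD _ _))// lerD2l (le_trans (norm_mulmx_le _ _))//.
  by rewrite norm_trmx mulrA.
have H3 : `|a| <= 2 * C1 * `|S^T *m a|.
  have := ler_wpM2l C10 H2; have := ler_wpM2r (normr_ge0 a) small.
  by move: H1; lra.
have H4 : `|S^T *m a| ^+ 2 <= nu%:R * (`|a| * `|S *m S^T *m a|).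
  apply: (le_trans (sqr_norm_le_dot _)).
  have -> : (S^T *m a)^T *m (S^T *m a) = a^T *m (S *m S^T *m a).
    by rewrite trmx_mul trmxK !mulmxA.
  exact: dot_le.
(* [H3] and [H4] bound [|a| ^+ 2] by a multiple of [|a|] times the norm of [S *m S^T *m a];
   cancelling one [|a|] requires it to be nonzero. *)
have [->|a0] := eqVneq `|a| 0; first by rewrite !mulr_ge0// sqr_ge0.
rewrite -(@ler_pM2l _ `|a|) ?lt0r ?a0//=.
have H5 : `|a| ^+ 2 <= (2 * C1 * `|S^T *m a|) ^+ 2.
  by rewrite lerXn2r ?nnegrE ?mulr_ge0.
rewrite -expr2 (le_trans H5)//.
have := ler_wpM2l (sqr_ge0 (2 * C1)) H4.
by rewrite !exprMn; lra.
Qed.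

End matrix_estimates.

(** * Averages of a field along a segment *)

Section quadrature_estimates.
Context {R : realType} {m M : nat}.
Variables (c b : 'I_M -> R).

Definition Qseg {a k : nat} (phi : 'cV[R]_m -> 'M[R]_(a, k)) (y x : 'cV[R]_m) :=
  quadrature c b (fun t => phi (y + t *: (x - y))).

(** One weight for the three estimates below: [1] pays for the values at [y], [|c i|] for the
    displacement along the segment. *)
Let wt := \sum_(i < M) `|b i| * (1 + `|c i|).

Lemma Qseg_bound {a k : nat} (phi : 'cV[R]_m -> 'M[R]_(a, k)) B :
  (forall x, `|phi x| <= B) -> forall y x, `|Qseg phi y x| <= wt * B.
Proof.
move=> HB y x; rewrite (le_trans (ler_norm_sum _ _ _))// mulr_suml.
apply: ler_sum => i _; rewrite normrZ -mulrA ler_wpM2l//.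
by rewrite (le_trans (HB _))// ler_peMl ?lerDl// (le_trans _ (HB y)).
Qed.

Lemma Qseg_lipschitz {a k : nat} (phi : 'cV[R]_m -> 'M[R]_(a, k)) B :
  0 <= B -> (forall x y, `|phi x - phi y| <= B * `|x - y|) ->
  forall y x y' x', `|Qseg phi y x - Qseg phi y' x'| <=
    wt * B * (`|y - y'| + `|x - x'|).
Proof.
move=> B0 HB y x y' x'; rewrite /Qseg /quadrature -sumrB.
rewrite (le_trans (ler_norm_sum _ _ _))// !mulr_suml.
apply: ler_sum => i _; rewrite -scalerBr normrZ -!mulrA ler_wpM2l//.
rewrite (le_trans (HB _ _))// mulrCA ler_wpM2l//.
have -> : y + c i *: (x - y) - (y' + c i *: (x' - y')) =
   (y - y') + c i *: ((x - x') - (y - y')).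
  by apply/matrixP => s t; rewrite !mxE; ring.
rewrite (le_trans (ler_normD _ _))// mulrDl mul1r.
have := ler_normB (x - x') (y - y').
move/(ler_wpM2l (normr_ge0 (c i))); rewrite -normrZ.
have := normr_ge0 (x - x'); lra.
Qed.

(** Rests on [\sum_i b i = 1], the case [k = 0] of the order condition. *)
Lemma Qseg_consistent {a k : nat} (phi : 'cV[R]_m -> 'M[R]_(a, k)) B q :
  quadrature_order c b q -> (0 < q)%N ->
  0 <= B -> (forall x y, `|phi x - phi y| <= B * `|x - y|) ->
  forall y x, `|Qseg phi y x - phi y| <= wt * B * `|x - y|.
Proof.
move=> ord q0 B0 HB y x.
have b1 : \sum_i b i = 1.
  have := ord 0%N q0; rewrite Rintegral_expr invr1 => ->.
  by apply: eq_bigr => i _; rewrite mulr1.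
have {1}-> : phi y = \sum_i b i *: phi y by rewrite -scaler_suml b1 scale1r.
rewrite /Qseg /quadrature -sumrB (le_trans (ler_norm_sum _ _ _))// !mulr_suml.
apply: ler_sum => i _; rewrite -scalerBr normrZ -!mulrA ler_wpM2l//.
rewrite (le_trans (HB _ _))// mulrCA ler_wpM2l// addrC addKr normrZ.
by rewrite ler_wpM2r// lerDr.
Qed.

End quadrature_estimates.

(** * Perturbation of the projected fields *)

Section residual.
Context {R : realType} {m nu M : nat}.
Variables (c b : 'I_M -> R).

Definition bounded_lipschitz {a k : nat} (B : R) (phi : 'cV[R]_m -> 'M[R]_(a, k)) :=
  [/\ 0 <= B, forall x, `|phi x| <= B &
      forall x y, `|phi x - phi y| <= B * `|x - y|].

Lemma Ckb_bounded_lipschitz {a k : nat} j (phi : 'cV[R]_m -> 'M[R]_(a, k)) :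
  Ckb j.+1 phi -> exists B, bounded_lipschitz B phi.
Proof.
move=> phij; have [B B0 HB] := Ckb_bounded phij.
have [K K0 HK] := Ckb_lipschitz_mx (Ckb_le (ltn0Sn j) phij).
exists (B + K); split=> [|x|x y]; first exact: addr_ge0.
  by rewrite (le_trans (HB x))// lerDl.
by rewrite (le_trans (HK x y))// ler_wpM2r// lerDr.
Qed.

Lemma norm_mulmx_le2 (a k l : nat) (A : 'M[R]_(a, k)) (B : 'M[R]_(k, l)) (s t : R) :
  `|A| <= s -> `|B| <= t -> `|A *m B| <= k%:R * (s * t).
Proof.
by move=> As Bt; rewrite (le_trans (norm_mulmx_le A B))// ler_wpM2l// ler_pM.
Qed.

Definition normal_equation (J : 'cV[R]_m -> 'M[R]_(nu, m)) (g : 'cV[R]_m -> 'cV[R]_m)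
    (y x : 'cV[R]_m) (a : 'cV[R]_nu) :=
  Qseg c b J y x *m (Qseg c b J y x)^T *m a = Qseg c b J y x *m Qseg c b g y x.

(** The field that a step really follows: the averaged [g] minus its orthogonal projection on the
    row space of the averaged Jacobian. *)
Definition residual (J : 'cV[R]_m -> 'M[R]_(nu, m)) (g : 'cV[R]_m -> 'cV[R]_m)
    (y x : 'cV[R]_m) (a : 'cV[R]_nu) :=
  Qseg c b g y x - (Qseg c b J y x)^T *m a.

Variables (q : nat) (J : 'cV[R]_m -> 'M[R]_(nu, m)).
Hypotheses (ord : quadrature_order c b q) (q0 : (0 < q)%N).

Lemma averaged_gram_lower_bound (B B' : R) : bounded_lipschitz B J ->
  (forall y, J y *m (J y)^T \in unitmx) ->
  (forall y, `|invmx (J y *m (J y)^T)| <= B') ->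
  exists delta C : R, [/\ 0 < delta, 0 <= C & forall y x, `|x - y| <= delta ->
    forall a : 'cV_nu, `|a| <= C * `|Qseg c b J y x *m (Qseg c b J y x)^T *m a|].
Proof.
move=> [B0 JB JK] Ju HB'.
have B'0 : 0 <= B' by apply: le_trans (HB' 0).
set wt := \sum_(i < M) `|b i| * (1 + `|c i|).
have wt0 : 0 <= wt by apply: sumr_ge0 => i _; rewrite mulr_ge0// addr_ge0.
set k := nu%:R * (B' * (m%:R * B)) * (nu%:R * (wt * B)).
have k0 : 0 <= k by rewrite !mulr_ge0.
(* [k * |x - y|] is the perturbation that has to stay below 1/2; [k + 1] replaces [k] because [k]
   may vanish. *)
exists (2 * (k + 1))^-1, (4 * (nu%:R * (B' * (m%:R * B))) ^+ 2 * nu%:R).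
split => [||y x xy a]; first by rewrite invr_gt0 mulr_gt0// ltr_wpDl.
  by rewrite !mulr_ge0// sqr_ge0.
apply: (@perturbed_gram_lower_bound _ _ _ (J y) _ (invmx (J y *m (J y)^T))) => //.
  by rewrite mulVmx.
have H : `|J y - Qseg c b J y x| <= wt * B * `|x - y|.
  by rewrite distrC; exact: (Qseg_consistent ord q0 B0 JK).
apply: (@le_trans _ _ (k * `|x - y|)).
  have -> : k * `|x - y| =
      nu%:R * (B' * (m%:R * B)) * (nu%:R * (wt * B * `|x - y|)) by rewrite /k; ring.
  by rewrite ler_wpM2l ?mulr_ge0// ler_wpM2l.
rewrite (le_trans (ler_wpM2l k0 xy))// invfM mulrCA ler_piMr ?invr_ge0//.
by rewrite ler_pdivrMr ?mul1r ?lerDl// ltr_wpDl.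
Qed.

(** The first bound has no smallness condition, as it only uses the projection property; it later
    yields the a priori estimate of [|x - y|]. For the second, tangency makes the right side of the
    normal equation, hence [a], of order [|x - y|]. For the third, the Gram lower bound is applied
    to [a - a']. *)
Lemma residual_estimates (B Bg delta C3 : R) (g : 'cV[R]_m -> 'cV[R]_m) :
  bounded_lipschitz B J -> bounded_lipschitz Bg g -> (forall y, J y *m g y = 0) ->
  0 <= C3 ->
  (forall y x, `|x - y| <= delta -> forall a : 'cV_nu,
     `|a| <= C3 * `|Qseg c b J y x *m (Qseg c b J y x)^T *m a|) ->
  exists C : R, [/\ 0 <= C,
    forall y x a, normal_equation J g y x a -> `|residual J g y x a| <= C,
    forall y x a, normal_equation J g y x a -> `|x - y| <= delta ->
      `|residual J g y x a - g y| <= C * `|x - y| &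
    forall y x a y' x' a', normal_equation J g y x a -> normal_equation J g y' x' a' ->
      `|x - y| <= delta -> `|x' - y'| <= delta ->
      `|residual J g y x a - residual J g y' x' a'| <=
         C * (`|y - y'| + `|x - x'|)].
Proof.
move=> [B0 JB JK] [Bg0 gB gK] Jg C30 HC3.
set wt := \sum_(i < M) `|b i| * (1 + `|c i|).
have wt0 : 0 <= wt by apply: sumr_ge0 => i _; rewrite mulr_ge0// addr_ge0.
set la := wt * B; set ga := wt * Bg.
have la0 : 0 <= la by rewrite mulr_ge0.
have ga0 : 0 <= ga by rewrite mulr_ge0.
have Lb y x : `|Qseg c b J y x| <= la := Qseg_bound c b JB y x.
have Gb y x : `|Qseg c b g y x| <= ga := Qseg_bound c b gB y x.
have LK := Qseg_lipschitz c b B0 JK; rewrite -/wt -/la in LK.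
have GK := Qseg_lipschitz c b Bg0 gK; rewrite -/wt -/ga in GK.
have LC := Qseg_consistent ord q0 B0 JK; rewrite -/wt -/la in LC.
have GC := Qseg_consistent ord q0 Bg0 gK; rewrite -/wt -/ga in GC.
pose Ca := C3 * (m%:R * (la * ga)).
have Ca0 : 0 <= Ca by rewrite !mulr_ge0.
have aCa y x a : normal_equation J g y x a -> `|x - y| <= delta -> `|a| <= Ca.
  move=> Na xy; rewrite (le_trans (HC3 _ _ xy a))// ler_wpM2l// Na.
  exact: norm_mulmx_le2.
pose K2 := nu%:R * (la * (C3 * (m%:R * (la * ga) + m%:R * (B * ga)))).
pose K3 := nu%:R * (la * Ca) + nu%:R * (la * (C3 * (m%:R * (la * ga) + m%:R * (la * ga) +
   nu%:R * ((m%:R * (la * la) + m%:R * (la * la)) * Ca)))).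
have K20 : 0 <= K2 by rewrite !mulr_ge0// addr_ge0// !mulr_ge0.
have K30 : 0 <= K3.
  by rewrite /K3 !(addr_ge0, mulr_ge0).
have mga0 : 0 <= m%:R * ga by rewrite mulr_ge0.
have gaK2 : 0 <= ga + K2 by rewrite addr_ge0.
have gaK3 : 0 <= ga + K3 by rewrite addr_ge0.
exists (m%:R * ga + (ga + K2) + (ga + K3)); split.
- exact: addr_ge0 (addr_ge0 _ _) _.
- move=> y x a Na; rewrite (le_trans (normal_equation_residual_le Na))//.
  apply: (@le_trans _ _ (m%:R * ga)); first by rewrite ler_wpM2l.
  by rewrite -addrA lerDl addr_ge0.
- move=> y x a Na xy.
  apply: (@le_trans _ _ ((ga + K2) * `|x - y|)); last first.
    by rewrite ler_wpM2r// addrAC lerDr addr_ge0.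
  rewrite /residual addrAC (le_trans (ler_normB _ _))// mulrDl lerD//.
  have Ha : `|a| <= C3 * ((m%:R * (la * ga) + m%:R * (B * ga)) * `|x - y|).
    rewrite (le_trans (HC3 _ _ xy a))// ler_wpM2l// Na.
    (* Subtracting [J y *m g y = 0] leaves two terms, each with a factor of order [|x - y|] by
       consistency of the averages. *)
    have -> : Qseg c b J y x *m Qseg c b g y x =
        (Qseg c b J y x - J y) *m Qseg c b g y x + J y *m (Qseg c b g y x - g y).
      by rewrite mulmxBl mulmxBr Jg subr0 subrK.
    rewrite (le_trans (ler_normD _ _))// mulrDl lerD//.
      rewrite (le_trans (norm_mulmx_le2 (LC y x) (Gb y x)))//.
      by rewrite le_eqVlt; apply/orP; left; apply/eqP; ring.
    rewrite (le_trans (norm_mulmx_le2 (JB y) (GC y x)))//.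
    by rewrite le_eqVlt; apply/orP; left; apply/eqP; ring.
  have ST : `|(Qseg c b J y x)^T| <= la by rewrite norm_trmx.
  rewrite (le_trans (norm_mulmx_le2 ST Ha))//.
  by rewrite /K2 le_eqVlt; apply/orP; left; apply/eqP; ring.
- move=> y x a y' x' a' Na Na' xy xy'.
  set E := `|y - y'| + `|x - x'|; have E0 : 0 <= E by rewrite addr_ge0.
  apply: (@le_trans _ _ ((ga + K3) * E)); last first.
    by rewrite ler_wpM2r// lerDr addr_ge0.
  have LL := LK y x y' x'; have GG := GK y x y' x'.
  have {}Lb1 := Lb y x; have Lb2 := Lb y' x'.
  have {}Gb1 := Gb y x; have Gb2 := Gb y' x'.
  have {}HC := HC3 _ _ xy (a - a').
  have Ha := aCa _ _ _ Na xy; have Ha' := aCa _ _ _ Na' xy'.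
  move: Na Na'; rewrite /normal_equation /residual.
  move: LL GG Lb1 Lb2 Gb1 Gb2 HC; rewrite -/E.
  move: (Qseg c b J y x) (Qseg c b J y' x') (Qseg c b g y x) (Qseg c b g y' x').
  move=> S S' G G' LL GG Lb1 Lb2 Gb1 Gb2 HC Na Na'.
  have -> : G - S^T *m a - (G' - S'^T *m a') =
      (G - G') - ((S - S')^T *m a + S'^T *m (a - a')).
    have -> : (S - S')^T *m a + S'^T *m (a - a') = S^T *m a - S'^T *m a'.
      by rewrite [(S - S')^T]linearB/= mulmxBl mulmxBr subrKA.
    move: (S^T *m a) (S'^T *m a') => p p'.
    by apply/matrixP => i j; rewrite !mxE; ring.
  rewrite (le_trans (ler_normB _ _))// mulrDl lerD//.
  have LLT : `|(S - S')^T| <= la * E by rewrite norm_trmx.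
  have S'T : `|S'^T| <= la by rewrite norm_trmx.
  have ST : `|S^T| <= la by rewrite norm_trmx.
  (* The difference of the two normal equations, arranged so that each term on the right contains
     [S - S'] or [G - G']. *)
  have SSaa : S *m S^T *m (a - a') = (S - S') *m G + S' *m (G - G') -
      ((S - S') *m S^T + S' *m (S - S')^T) *m a'.
    have -> : (S - S') *m G + S' *m (G - G') = S *m G - S' *m G'.
      by rewrite mulmxBl mulmxBr subrKA.
    have -> : (S - S') *m S^T + S' *m (S - S')^T = S *m S^T - S' *m S'^T.
      by rewrite [(S - S')^T]linearB/= mulmxBl mulmxBr subrKA.
    by rewrite mulmxBr mulmxBl Na Na' opprB addrA subrK.
  have Haa : `|a - a'| <= C3 * ((m%:R * (la * ga) + m%:R * (la * ga) +
      nu%:R * ((m%:R * (la * la) + m%:R * (la * la)) * Ca)) * E).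
    rewrite (le_trans HC)// ler_wpM2l// SSaa (le_trans (ler_normB _ _))// mulrDl lerD//.
      rewrite (le_trans (ler_normD _ _))// mulrDl lerD//.
        rewrite (le_trans (norm_mulmx_le2 LL Gb1))//.
        by rewrite le_eqVlt; apply/orP; left; apply/eqP; ring.
      rewrite (le_trans (norm_mulmx_le2 Lb2 GG))//.
      by rewrite le_eqVlt; apply/orP; left; apply/eqP; ring.
    have H : `|(S - S') *m S^T + S' *m (S - S')^T| <=
       (m%:R * (la * la) + m%:R * (la * la)) * E.
      rewrite (le_trans (ler_normD _ _))// mulrDl lerD//.
        rewrite (le_trans (norm_mulmx_le2 LL ST))//.
        by rewrite le_eqVlt; apply/orP; left; apply/eqP; ring.
      rewrite (le_trans (norm_mulmx_le2 Lb2 LLT))//.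
      by rewrite le_eqVlt; apply/orP; left; apply/eqP; ring.
    rewrite (le_trans (norm_mulmx_le2 H Ha'))//.
    by rewrite le_eqVlt; apply/orP; left; apply/eqP; ring.
  rewrite (le_trans (ler_normD _ _))// /K3 mulrDl lerD//.
    rewrite (le_trans (norm_mulmx_le2 LLT Ha))//.
    by rewrite le_eqVlt; apply/orP; left; apply/eqP; ring.
  rewrite (le_trans (norm_mulmx_le2 S'T Haa))//.
  by rewrite le_eqVlt; apply/orP; left; apply/eqP; ring.
Qed.

End residual.

(** * One step of the scheme *)

Section scheme_step.
Context {R : realType} {m nu D M : nat}.
Variables (c b : 'I_M -> R) (q : nat) (J : 'cV[R]_m -> 'M[R]_(nu, m)).
Variables (f : 'cV[R]_m -> 'cV[R]_m) (g : 'I_D -> 'cV[R]_m -> 'cV[R]_m).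
Hypotheses (ord : quadrature_order c b q) (q0 : (0 < q)%N).

(** The increments are free real variables, so that the estimates are deterministic and can compare
    two outcomes. *)
Definition scheme_step (h : R) (z : 'I_D -> R) (y x : 'cV[R]_m) :=
  exists (a0 : 'cV[R]_nu) (a : 'I_D -> 'cV[R]_nu),
    [/\ x = y + h *: residual c b J f y x a0
              + \sum_(r < D) z r *: residual c b J (g r) y x (a r),
        normal_equation c b J f y x a0 &
        forall r, normal_equation c b J (g r) y x (a r)].

Let addrDDK (V : zmodType) (u v w : V) : u + v + w - u = v + w.
Proof. by rewrite -[u + v + w]addrA [u + _]addrC addrK. Qed.

(** The normal equation says precisely that the averaged Jacobian annihilates each residual. *)
Lemma scheme_step_orthogonal h z y x :
  scheme_step h z y x -> Qseg c b J y x *m (x - y) = 0.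
Proof.
move=> [a0 [a [xE N0 Na]]].
have res0 (k : 'cV[R]_m -> 'cV[R]_m) d : normal_equation c b J k y x d ->
    Qseg c b J y x *m residual c b J k y x d = 0.
  by move=> Nd; rewrite /residual mulmxBr mulmxA Nd subrr.
have -> : x - y = h *: residual c b J f y x a0
              + \sum_(r < D) z r *: residual c b J (g r) y x (a r).
  by rewrite {1}xE addrDDK.
rewrite mulmxDr -scalemxAr res0// scaler0 add0r mulmx_sumr big1// => r _.
by rewrite -scalemxAr res0// scaler0.
Qed.

(** The global bound comes first: it puts [x] close to [y], after which the local residual estimates
    apply. With equal data the last estimate is uniqueness of the implicit step. *)
Lemma scheme_step_estimates (B B' Bf : R) (Bg : 'I_D -> R) :
  bounded_lipschitz B J ->
  (forall y, J y *m (J y)^T \in unitmx) ->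
  (forall y, `|invmx (J y *m (J y)^T)| <= B') ->
  bounded_lipschitz Bf f -> (forall r, bounded_lipschitz (Bg r) (g r)) ->
  (forall y, J y *m f y = 0) -> (forall r y, J y *m g r y = 0) ->
  exists C delta : R, [/\ 0 <= C, 0 < delta,
    forall h z y x, 0 <= h -> scheme_step h z y x ->
      `|x - y| <= C * (h + \sum_r `|z r|),
    forall h z y x, 0 <= h -> h + \sum_r `|z r| <= delta -> scheme_step h z y x ->
      `|x - y - \sum_r z r *: g r y| <= C * (h + (\sum_r `|z r|) ^+ 2) &
    forall h z y x z' y' x', 0 <= h ->
      h + \sum_r `|z r| <= delta -> h + \sum_r `|z' r| <= delta ->
      scheme_step h z y x -> scheme_step h z' y' x' ->
      `|x - x'| <= C * (`|y - y'| + \sum_r `|z r - z' r|)].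
Proof.
move=> blJ Ju Jinv blf blg Jf Jg.
have [d [C3 [d0 C30 HC3]]] := averaged_gram_lower_bound ord q0 blJ Ju Jinv.
have [Cf [Cf0 Hf1 Hf2 Hf3]] := residual_estimates ord q0 blJ blf Jf C30 HC3.
have /choice[Cg HCg] := fun r => residual_estimates ord q0 blJ (blg r) (Jg r) C30 HC3.
have Cg0 r : 0 <= Cg r by case: (HCg r).
pose C := Cf + \sum_r Cg r.
have C0 : 0 <= C by rewrite addr_ge0// sumr_ge0.
have CfC : Cf <= C by rewrite lerDl sumr_ge0.
have CgC r : Cg r <= C.
  rewrite /C (bigD1 r)//= addrCA lerDl addr_ge0// sumr_ge0//.
have S0 (z : 'I_D -> R) : 0 <= \sum_r `|z r| by exact: sumr_ge0.
have step_le h z y x : 0 <= h -> scheme_step h z y x ->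
    `|x - y| <= C * (h + \sum_r `|z r|).
  move=> h0 [a0 [a [xE N0 Na]]].
  have -> : x - y = h *: residual c b J f y x a0
              + \sum_(r < D) z r *: residual c b J (g r) y x (a r).
    by rewrite {1}xE addrDDK.
  rewrite (le_trans (ler_normD _ _))// mulrDr lerD//.
    rewrite normrZ ger0_norm// mulrC ler_wpM2r//.
    by rewrite (le_trans (Hf1 _ _ _ N0)).
  rewrite (le_trans (ler_norm_sum _ _ _))// mulr_sumr ler_sum// => r _.
  rewrite normrZ mulrC ler_wpM2r//.
  by case: (HCg r) => _ H _ _; rewrite (le_trans (H _ _ _ (Na r))).
(* [1] gives [s * h <= h], [d / (C + 1)] keeps the step in the range of the Gram bound, and the last
   entry makes the implicit equation contract with factor 1/2. *)
pose delta := Num.min 1 (Num.min (d / (C + 1)) (2 * (C + 1))^-1).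
have C1 : 0 < C + 1 by rewrite ltr_wpDl.
have delta0 : 0 < delta by rewrite !lt_min ltr01 divr_gt0//= invr_gt0 mulr_gt0.
have smallP t : t <= delta -> [/\ t <= 1, C * t <= d & C * t <= 2^-1].
  rewrite /delta !le_min => /and3P[-> td tC]; split => //.
    have [t0|/ltW t0] := leP 0 t; last first.
      by rewrite (le_trans _ (ltW d0))// mulr_ge0_le0.
    rewrite (le_trans (ler_wpM2r t0 (_ : C <= C + 1)))// ?lerDl//.
    by rewrite mulrC -ler_pdivlMr.
  have [t0|/ltW t0] := leP 0 t; last first.
    by rewrite (@le_trans _ _ 0)// mulr_ge0_le0.
  rewrite (le_trans (ler_wpM2r t0 (_ : C <= C + 1)))// ?lerDl//.
  by rewrite mulrC -ler_pdivlMr// -invfM.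
have CC : 0 <= C * C by rewrite mulr_ge0.
exists (C + C * C + C * C + 3 + 2 * C), delta; split => //.
- lra.
- move=> h z y x h0 st; rewrite (le_trans (step_le h z y x h0 st))//.
  rewrite ler_wpM2r ?addr_ge0//.
  lra.
- move=> h z y x h0 /smallP[hs1 Chs _] st.
  have xy := step_le _ _ _ _ h0 st.
  have xyd := le_trans xy Chs.
  move: st => [a0 [a [xE N0 Na]]].
  have -> : x - y - \sum_r z r *: g r y = h *: residual c b J f y x a0
              + \sum_(r < D) z r *: (residual c b J (g r) y x (a r) - g r y).
    under [in RHS]eq_bigr do rewrite scalerBr.
    rewrite sumrB addrA; congr (_ - _).
    by rewrite {1}xE addrDDK.
  set s := \sum_r `|z r| in hs1 xy Chs *.
  have s0 : 0 <= s by exact: S0.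
  have H1 : `|h *: residual c b J f y x a0| <= C * h.
    by rewrite normrZ ger0_norm// mulrC ler_wpM2r// (le_trans (Hf1 _ _ _ N0)).
  have H2 : `|\sum_(r < D) z r *: (residual c b J (g r) y x (a r) - g r y)| <=
      s * (C * (C * (h + s))).
    rewrite (le_trans (ler_norm_sum _ _ _))// mulr_suml ler_sum// => r _.
    rewrite normrZ ler_wpM2l//.
    case: (HCg r) => _ _ H _; rewrite (le_trans (H _ _ _ (Na r) xyd))//.
    by rewrite ler_pM.
  rewrite (le_trans (ler_normD _ _))// (le_trans (lerD H1 H2))//.
  have sh : s * h <= h by rewrite ler_piMl// (le_trans _ hs1)// lerDr.
  have h1 := ler_wpM2l CC sh.
  have s2 : 0 <= s ^+ 2 by rewrite sqr_ge0.
  have h2 := mulr_ge0 C0 s2; have h3 := mulr_ge0 C0 h0.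
  have h4 := mulr_ge0 CC s2; have h5 := mulr_ge0 CC h0.
  have -> : s * (C * (C * (h + s))) = C * C * (s * h) + C * C * s ^+ 2 by ring.
  lra.
- move=> h z y x z' y' x' h0 /smallP[_ Cd C2] /smallP[_ Cd' C2'] st st'.
  have xyd := le_trans (step_le _ _ _ _ h0 st) Cd.
  have xyd' := le_trans (step_le _ _ _ _ h0 st') Cd'.
  move: st st' => [a0 [a [xE N0 Na]]] [a0' [a' [xE' N0' Na']]].
  set E := `|y - y'| + `|x - x'|; have E0 : 0 <= E by rewrite addr_ge0.
  set r0 := residual c b J f y x a0 in xE.
  set r0' := residual c b J f y' x' a0' in xE'.
  pose rr r := residual c b J (g r) y x (a r).
  pose rr' r := residual c b J (g r) y' x' (a' r).
  have xxE : x - x' = (y - y') + h *: (r0 - r0') + \sum_r z r *: (rr r - rr' r) +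
      \sum_r (z r - z' r) *: rr' r.
    rewrite -[RHS]addrA -big_split/=.
    under [in RHS]eq_bigr do rewrite scalerBr scalerBl subrKA.
    rewrite sumrB scalerBr.
    have -> : x = y + h *: r0 + \sum_r z r *: rr r by exact: xE.
    have -> : x' = y' + h *: r0' + \sum_r z' r *: rr' r by exact: xE'.
    move: (\sum_r z r *: rr r) (\sum_r z' r *: rr' r) (h *: r0) (h *: r0') => p p' w w'.
    by apply/matrixP => i j; rewrite !mxE; ring.
  have H1 : `|h *: (r0 - r0')| <= h * (C * E).
    rewrite normrZ ger0_norm// ler_wpM2l//.
    by rewrite (le_trans (Hf3 _ _ _ _ _ _ N0 N0' xyd xyd'))// ler_wpM2r.
  have H2 : `|\sum_r z r *: (rr r - rr' r)| <= (\sum_r `|z r|) * (C * E).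
    rewrite (le_trans (ler_norm_sum _ _ _))// mulr_suml ler_sum// => r _.
    rewrite normrZ ler_wpM2l//; case: (HCg r) => _ _ _ H.
    by rewrite (le_trans (H _ _ _ _ _ _ (Na r) (Na' r) xyd xyd'))// ler_wpM2r.
  have H3 : `|\sum_r (z r - z' r) *: rr' r| <= (\sum_r `|z r - z' r|) * C.
    rewrite (le_trans (ler_norm_sum _ _ _))// mulr_suml ler_sum// => r _.
    rewrite normrZ ler_wpM2l//; case: (HCg r) => _ H _ _.
    by rewrite (le_trans (H _ _ _ (Na' r))).
  have H : `|x - x'| <= `|y - y'| + h * (C * E) + (\sum_r `|z r|) * (C * E) +
      (\sum_r `|z r - z' r|) * C.
    rewrite {1}xxE (le_trans (ler_normD _ _))// lerD// (le_trans (ler_normD _ _))// lerD//.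
    by rewrite (le_trans (ler_normD _ _))// lerD.
  (* Half of [|x - x'|] is absorbed into the left side, whence the factors [3] and [2 * C] below. *)
  have H4 : h * (C * E) + (\sum_r `|z r|) * (C * E) <= 2^-1 * E.
    by rewrite -mulrDl mulrCA mulrA ler_wpM2r.
  have Z0 : 0 <= \sum_r `|z r - z' r| by exact: sumr_ge0.
  have : `|x - x'| <= 3 * `|y - y'| + 2 * C * \sum_r `|z r - z' r|.
    by move: H H4; rewrite /E; lra.
  move/le_trans; apply.
  rewrite [leRHS]mulrDr lerD// ler_wpM2r//.
    lra.
  lra.
Qed.

End scheme_step.

(** * Local expansion of the invariant *)

Section local_expansion.
Context {R : realType} {m D M : nat}.
Variables (c b : 'I_M -> R) (q : nat) (g : 'I_D -> 'cV[R]_m -> 'cV[R]_m).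
Variables (l : 'cV[R]_m -> R) (Bg : 'I_D -> R).
Hypotheses (ord : quadrature_order c b q) (q0 : (0 < q)%N).
Hypotheses (dl : forall x, differentiable l x)
  (Cl : forall i, Ckb q.+1 (fun x => 'D_(delta_mx i 0) l x))
  (blg : forall r, bounded_lipschitz (Bg r) (g r)).

(** An explicit homogeneous polynomial in [z] once [y] is fixed, unlike the derivative in the
    direction of the implicit increment. *)
Definition leading_term (y : 'cV[R]_m) (z : 'I_D -> R) : R :=
  error_constant q c b * dpow q.+1 l (\sum_r z r *: g r y) y.

Let dpow_l_lip : exists2 C, 0 <= C & dpow_lipschitz_with q.+1 l C.
Proof.
apply: dpowS_lipschitz => i; last exact: dpow_lipschitz.
by apply: dpow_bound; exact: Ckb_pred.
Qed.

Let dpow_l_bound : exists2 C, 0 <= C &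
  forall u y, `|dpow q.+1 l u y| <= C * `|u| ^+ q.+1.
Proof. by apply: dpowS_bound => i; apply: dpow_bound; exact: Ckb_pred. Qed.

Let SBg := \sum_r Bg r.

Let Bg0 r : 0 <= Bg r. Proof. by case: (blg r). Qed.

Let SBg0 : 0 <= SBg. Proof. exact: sumr_ge0. Qed.

Let Bg_le r : Bg r <= SBg.
Proof. by rewrite /SBg (bigD1 r)//= lerDl sumr_ge0. Qed.

Let noise_bound (z : 'I_D -> R) y :
  `|\sum_r z r *: g r y| <= SBg * \sum_r `|z r|.
Proof.
rewrite (le_trans (ler_norm_sum _ _ _))// mulr_sumr ler_sum// => r _.
rewrite normrZ mulrC ler_wpM2r//; case: (blg r) => _ H _.
by rewrite (le_trans (H y)).
Qed.

Let noise_lipschitz (z z' : 'I_D -> R) y y' :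
  `|\sum_r z r *: g r y - \sum_r z' r *: g r y'| <=
  SBg * ((\sum_r `|z r|) * `|y - y'| + \sum_r `|z r - z' r|).
Proof.
rewrite -sumrB (le_trans (ler_norm_sum _ _ _))//.
rewrite [X in SBg * (X + _)]mulr_suml -big_split/= mulr_sumr.
apply: ler_sum => r _.
have -> : z r *: g r y - z' r *: g r y' =
    z r *: (g r y - g r y') + (z r - z' r) *: g r y'.
  by rewrite scalerBr scalerBl subrKA.
case: (blg r) => _ H H'.
rewrite (le_trans (ler_normD _ _))// mulrDr !normrZ lerD//.
  rewrite mulrCA ler_wpM2l// (le_trans (H' _ _))// ler_wpM2r//.
by rewrite mulrC ler_wpM2r// (le_trans (H _)).
Qed.

Lemma leading_term_bound : exists2 C, 0 <= C &
  forall y z, `|leading_term y z| <= C * (\sum_r `|z r|) ^+ q.+1.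
Proof.
have [C C0 HC] := dpow_l_bound.
exists (`|error_constant q c b| * (C * SBg ^+ q.+1)) => [|y z].
  by rewrite !mulr_ge0// exprn_ge0.
rewrite normrM -mulrA ler_wpM2l// (le_trans (HC _ _))// -mulrA -exprMn ler_wpM2l//.
by rewrite lerXn2r ?nnegrE// mulr_ge0// sumr_ge0.
Qed.

(** The sign is -1 exactly for even [q]: this is where the parity of [q] enters. *)
Lemma leading_termN y z :
  leading_term y (fun r => - z r) = (-1) ^+ q.+1 * leading_term y z.
Proof.
rewrite /leading_term.
under eq_bigr do rewrite scaleNr.
by rewrite sumrN dpowN mulrCA.
Qed.

(** Serves measurability only, so [C] may depend on the size [a] of the increments and thereby on
    [h]. *)
Lemma leading_term_lipschitz (a : R) : 0 <= a -> exists2 C, 0 <= C &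
  forall y z y' z', (forall r, `|z r| <= a) -> (forall r, `|z' r| <= a) ->
    `|leading_term y z - leading_term y' z'| <=
    C * (`|y - y'| + \sum_r `|z r - z' r|).
Proof.
move=> a0; have [C C0 HC] := dpow_l_lip.
pose s := D%:R * a.
have s0 : 0 <= s by rewrite mulr_ge0.
pose rho := SBg * s + 1.
have rho0 : 0 < rho by rewrite ltr_wpDl// mulr_ge0.
have rho_ge0 := ltW rho0.
exists (`|error_constant q c b| * (C * rho ^+ q.+1 * (rho + SBg * s + SBg) / rho)).
  by rewrite !mulr_ge0// ?exprn_ge0// ?invr_ge0// !addr_ge0// mulr_ge0.
move=> y z y' z' za za'.
have sP (w : 'I_D -> R) : (forall r, `|w r| <= a) -> \sum_r `|w r| <= s.
  move=> wa; rewrite (le_trans (ler_sum _ (fun r _ => wa r)))//.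
  by rewrite sumr_const card_ord /s mulr_natl.
have zrho (w : 'I_D -> R) v : (forall r, `|w r| <= a) -> `|\sum_r w r *: g r v| <= rho.
  move=> wa; rewrite (le_trans (noise_bound _ _))//.
  by rewrite (le_trans (ler_wpM2l SBg0 (sP w wa)))// lerDl.
have := HC rho _ _ y y' (zrho z y za) (zrho z' y' za').
move=> H.
rewrite /leading_term -mulrBr normrM -[leRHS]mulrA; apply: ler_wpM2l => //.
rewrite mulrAC ler_pdivlMr// mulrC (le_trans H)//.
rewrite -[leRHS]mulrA ler_wpM2l//; first by rewrite mulr_ge0// exprn_ge0.
have N := noise_lipschitz z z' y y'.
set Y := `|y - y'| in N *; set Z := \sum_r `|z r - z' r| in N *.
have Y0 : 0 <= Y := normr_ge0 _; have Z0 : 0 <= Z by exact: sumr_ge0.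
have N' : SBg * ((\sum_r `|z r|) * Y + Z) <= SBg * (s * Y + Z).
  by rewrite ler_wpM2l// lerD2r ler_wpM2r// sP.
have h1 := mulr_ge0 SBg0 s0; have h2 := mulr_ge0 SBg0 Y0.
have h3 := mulr_ge0 h1 Z0; have h4 := mulr_ge0 rho_ge0 Z0.
have := le_trans N N'; nra.
Qed.

Lemma potential_lipschitz :
  exists2 C, 0 <= C & forall y y', `|l y - l y'| <= C * `|y - y'|.
Proof.
have [C C0 HC] : exists2 C, 0 <= C & forall u y, `|dpow 1 l u y| <= C * `|u| ^+ 1.
  apply: dpowS_bound => i; have [C C0 HC] := Ckb_bounded (Cl i).
  by exists C => // u y; rewrite mulr1; exact: HC.
exists C => // y y'; rewrite -[in l y](subrK y' y) [y - y' + y']addrC.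
by apply: line_lipschitz => // z; have := HC (y - y') z; rewrite expr1.
Qed.

Lemma scheme_step_expansion (nu : nat) (J : 'cV[R]_m -> 'M[R]_(nu, m))
    (f : 'cV[R]_m -> 'cV[R]_m) (i : 'I_nu) (C1 delta : R) :
  (forall y j, J y i j = 'D_(delta_mx j 0) l y) ->
  0 <= C1 ->
  (forall h z y x, 0 <= h -> scheme_step c b J f g h z y x ->
     `|x - y| <= C1 * (h + \sum_r `|z r|)) ->
  (forall h z y x, 0 <= h -> h + \sum_r `|z r| <= delta ->
     scheme_step c b J f g h z y x ->
     `|x - y - \sum_r z r *: g r y| <= C1 * (h + (\sum_r `|z r|) ^+ 2)) ->
  exists2 C, 0 <= C & forall h z y x, 0 < h <= 1 -> h + \sum_r `|z r| <= delta ->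
    scheme_step c b J f g h z y x ->
    `|l x - l y - leading_term y z| <= C * (Num.sqrt h + \sum_r `|z r|) ^+ q.+2 /\
    `|l x - l y| <= C * (Num.sqrt h + \sum_r `|z r|) ^+ q.+1.
Proof.
move=> JE C10 H1 H2.
have [CE CE0 HE] := quadrature_local_error ord dl Cl.
have [CL CL0 HL] := dpow_l_lip.
have [CB CB0 HB] := dpow_l_bound.
set ka := error_constant q c b in HE.
(* [C1] bounds [u] and [SBg] bounds [v], in units of [rho]; the [1] makes [K] positive for the
   division. *)
pose K := C1 + SBg + 1.
have K0 : 0 < K by rewrite ltr_wpDl// addr_ge0.
have Kge0 := ltW K0.
pose Ca := CE * K ^+ q.+2 + `|ka| * (CL * K ^+ q.+1 * C1 / K).
have kCL : 0 <= `|ka| * (CL * K ^+ q.+1 * C1 / K).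
  by rewrite !mulr_ge0// ?exprn_ge0// invr_ge0.
have Ca0 : 0 <= Ca by rewrite addr_ge0// mulr_ge0// exprn_ge0.
(* [1 + |delta|] bounds one factor [rho], which lowers [rho ^+ q.+2] to [rho ^+ q.+1]. *)
pose Cb := CE * K ^+ q.+2 * (K + 1 + `|delta|) + `|ka| * (CB * K ^+ q.+1).
have kCB : 0 <= `|ka| * (CB * K ^+ q.+1) by rewrite !mulr_ge0// exprn_ge0.
have CEK : 0 <= CE * K ^+ q.+2 by rewrite mulr_ge0// exprn_ge0.
have Cb0 : 0 <= Cb.
  by rewrite addr_ge0// mulr_ge0//; have := normr_ge0 delta; lra.
exists (Ca + Cb) => [|h z y x /andP[h0 h1] hd st]; first exact: addr_ge0.
set s := \sum_r `|z r| in hd *.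
have s0 : 0 <= s by exact: sumr_ge0.
set rh := Num.sqrt h.
have rh0 : 0 < rh by rewrite sqrtr_gt0.
have rhh : rh ^+ 2 = h by rewrite sqr_sqrtr// ltW.
have rh1 : rh <= 1 by rewrite -sqrtr1 ler_wsqrtr.
have hrh : h <= rh by rewrite -rhh expr2 ler_piMl// ltW.
set rho := rh + s.
have rho0 : 0 < rho by rewrite ltr_wpDr.
have rho_ge0 := ltW rho0.
set u := x - y.
have u_rho : `|u| <= K * rho.
  have C1K : C1 <= K by rewrite /K -addrA lerDl addr_ge0.
  rewrite (le_trans (H1 _ _ _ _ (ltW h0) st))// ler_pM// ?addr_ge0// ?(ltW h0)//.
  by rewrite lerD2r.
set v := \sum_r z r *: g r y.
have v_rho : `|v| <= K * rho.
  rewrite (le_trans (noise_bound z y))// ler_pM//.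
    by rewrite /K addrAC lerDr addr_ge0.
  by rewrite -/s /rho lerDr ltW.
have uv : `|u - v| <= C1 * rho ^+ 2.
  rewrite (le_trans (H2 _ _ _ _ (ltW h0) hd st))// ler_wpM2l// -rhh /rho -/s.
  by have := mulr_ge0 (ltW rh0) s0; rewrite sqrrD; lra.
(* Row [i] of the orthogonality relation: the quadrature sum in the local error vanishes. *)
have ort : \sum_(k < M) b k * dpow 1 l u (y + c k *: u) = 0.
  have /matrixP /(_ i 0) := scheme_step_orthogonal st.
  rewrite [RHS]mxE => E0; rewrite -[RHS]E0 mxE /Qseg /quadrature.
  under [RHS]eq_bigr do rewrite summxE mulr_suml.
  rewrite exchange_big/=; apply: eq_bigr => k _.
  rewrite mulr_sumr; apply: eq_bigr => j _.
  have -> : (b k *: J (y + c k *: u)) i j = b k * J (y + c k *: u) i j by rewrite mxE.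
  by rewrite JE -[(x - y) j 0]/(u j 0) mulrAC mulrA.
have := HE y u; rewrite ort subr0 [y + u]addrC subrK => HEu.
have uq : CE * `|u| ^+ q.+2 <= CE * K ^+ q.+2 * rho ^+ q.+2.
  rewrite -mulrA -exprMn ler_wpM2l// lerXn2r ?nnegrE// mulr_ge0//.
have Krho0 : 0 < K * rho by rewrite mulr_gt0.
have lead : `|dpow q.+1 l u y - dpow q.+1 l v y| <= (CL * K ^+ q.+1 * C1 / K) * rho ^+ q.+2.
  (* With the same base point only [|u - v| = O(rho ^+ 2)] remains; dividing by [K * rho] leaves the
     power [q.+2]. *)
  have := HL (K * rho) u v y y u_rho v_rho; rewrite subrr normr0 mulr0 add0r.
  move=> H; rewrite -(ler_pM2l Krho0) (le_trans H)//.
  have CK0 : 0 <= CL * (K * rho) ^+ q.+1 by rewrite mulr_ge0// exprn_ge0// ltW.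
  rewrite (le_trans (ler_wpM2l CK0 uv))// le_eqVlt; apply/orP; left; apply/eqP.
  rewrite exprMn [in RHS](exprS rho q.+1).
  by field; rewrite gt_eqF.
split.
  have -> : l x - l y - leading_term y z = (l x - l y - ka * dpow q.+1 l u y) +
      ka * (dpow q.+1 l u y - dpow q.+1 l v y).
    by rewrite /leading_term -/ka -/v; ring.
  rewrite (le_trans (ler_normD _ _))//.
  apply: (@le_trans _ _ (Ca * rho ^+ q.+2)); last first.
    by rewrite ler_wpM2r ?exprn_ge0// lerDl.
  rewrite /Ca [leRHS]mulrDl lerD// ?(le_trans HEu)//.
  by rewrite normrM -[leRHS]mulrA ler_wpM2l.
apply: (@le_trans _ _ (Cb * rho ^+ q.+1)); last first.
  by rewrite ler_wpM2r ?exprn_ge0// lerDr.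
have -> : l x - l y = (l x - l y - ka * dpow q.+1 l u y) + ka * dpow q.+1 l u y.
  by rewrite subrK.
rewrite (le_trans (ler_normD _ _))// /Cb [leRHS]mulrDl lerD//.
  rewrite (le_trans HEu)// (le_trans uq)// (exprS rho q.+1) [leLHS]mulrA.
  rewrite ler_wpM2r ?exprn_ge0//.
  rewrite (ler_wpM2l CEK)//.
  have sd : s <= `|delta| by rewrite (le_trans _ (ler_norm _))// (le_trans _ hd)// lerDr ltW.
  by rewrite /rho -addrA (le_trans (lerD rh1 sd))// lerDr.
rewrite normrM -mulrA ler_wpM2l// (le_trans (HB _ _))// -mulrA -exprMn ler_wpM2l//.
by rewrite lerXn2r ?nnegrE// mulr_ge0.
Qed.

End local_expansion.

(** * Measurability of Lipschitz images *)

Section lipschitz_measurability.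
Context {R : realType}.

(* On a cell of the grid of mesh [1 / k.+1] on the values of [U], the function
   [X] varies by at most [C * #|I| / k.+1], so [X < a] is locally decided by the
   cell for [k] large. *)
Lemma lipschitz_in_measurable (d : measure_display) (T : measurableType d)
    (I : finType) (U : I -> T -> R) (X : T -> R) (A0 : set T) (C : R) :
  (forall i, measurable_fun [set: T] (U i)) ->
  (forall A, A `<=` ~` A0 -> measurable A) ->
  0 <= C ->
  (forall w w', A0 w -> A0 w' -> `|X w - X w'| <= C * \sum_i `|U i w - U i w'|) ->
  measurable_fun [set: T] X.
Proof.
move=> mU mA0C C0 XU.
have mA0 : measurable A0 by rewrite -[A0]setCK; apply: measurableC; exact: mA0C.
apply: (measurability _ (RGenInftyO.measurableE R)) => // _ [_ [a ->] <-].
rewrite setTI; set Y := _ @^-1` _.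
have -> : Y = (A0 `&` Y) `|` (Y `&` ~` A0).
  by rewrite [A0 `&` Y]setIC -setIUr setUv setIT.
apply: measurableU; last by apply: mA0C => w [].
pose cell (kc : nat * {ffun I -> int}) := \bigcap_(i in [set: I])
  (U i @^-1` `[(kc.2 i)%:~R / kc.1.+1%:R, (kc.2 i + 1)%:~R / kc.1.+1%:R[%classic).
pose good kc := forall w, A0 w -> cell kc w -> X w < a.
(* A countable union: a cell is indexed by a mesh and finitely many integers, and it is kept when
   [X < a] on all of its part in [A0]. *)
have -> : A0 `&` Y =
    A0 `&` \bigcup_(kc : nat * {ffun I -> int}) (if `[< good kc >] then cell kc else set0).
  apply/seteqP; split => [w [A0w Yw]|w [A0w [kc _]]]; last first.
    case: asboolP => // gkc ckc; split => //.
    by rewrite /Y /= in_itv /=; exact: gkc.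
  split => //.
  have {}Yw : X w < a by move: Yw; rewrite /Y/= in_itv.
  pose k := Num.bound (C * #|I|%:R / (a - X w)).
  have kP : C * #|I|%:R / k.+1%:R < a - X w.
    have H : C * #|I|%:R / (a - X w) < k%:R.
      by apply: archi_boundP; rewrite divr_ge0 ?mulr_ge0// subr_ge0 ltW.
    rewrite ltr_pdivrMr// [ltRHS]mulrC -ltr_pdivrMr ?subr_gt0//.
    by rewrite (lt_le_trans H)// ler_nat.
  pose c : {ffun I -> int} := [ffun i => Num.floor (U i w * k.+1%:R)].
  have cellw : cell (k, c) w.
    move=> i _ /=; rewrite in_itv /= ffunE.
    by rewrite ler_pdivrMr// ltr_pdivlMr// floor_le floorD1_gt.
  exists (k, c) => //; case: asboolP => // -[] w' A0w' cellw'.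
  have := XU _ _ A0w' A0w.
  have : \sum_i `|U i w' - U i w| <= #|I|%:R / k.+1%:R.
    rewrite (le_trans (@ler_sum _ _ _ _ _ (fun=> k.+1%:R^-1) _))//; last first.
      by rewrite sumr_const mulr_natl.
    move=> i _; have := cellw i Logic.I; have := cellw' i Logic.I.
    rewrite /= !in_itv/= !intrD !mulr1z !mulrDl !mul1r => /andP[+ +] /andP[].
    move: ((c i)%:~R / k.+1%:R : R) (k.+1%:R^-1 : R) => s t a1 a2 a3 a4.
    by rewrite ler_norml; apply/andP; split; lra.
  move/(ler_wpM2l C0) => H1 H2; have := le_trans H2 H1; rewrite mulrA => H.
  by rewrite -(ltrD2r (- X w)) (le_lt_trans (ler_norm _))// (le_lt_trans H).
apply: measurableI => //; apply: countable_bigcupT_measurable => [|kc].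
  exact: countableP.
case: asboolP => // _; rewrite /cell.
apply: fin_bigcap_measurable => // i _; rewrite -[_ @^-1` _]setTI.
by apply: mU => //; exact: measurable_itv.
Qed.

(** Turns adaptedness to a bare family of sets such as [F t] into measurability of a function on a
    measurable type. *)
Lemma measurable_g_sigma_algebraP (d : measure_display) (Omega : measurableType d)
    (G : set (set Omega)) (X : Omega -> R) : sigma_algebra [set: Omega] G ->
  (forall B, measurable B -> G (X @^-1` B)) <->
  measurable_fun [set: g_sigma_algebraType G] X.
Proof.
move=> sG; split=> [GX _ B mB|mX B mB].
  by rewrite setTI; apply: sub_sigma_algebra; exact: GX.
by have := mX measurableT B mB; rewrite setTI /measurable/= sigma_algebra_id.
Qed.

End lipschitz_measurability.

(** * Odd functionals of independent symmetric increments *)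

Section odd_expectation.
Context {R : realType} {d : measure_display} {Omega : measurableType d}.
Context {D : nat}.

(** A pi-system generating the product of [G] with the Borel structure of the increments;
    independence is a formula for the probability of such sets. *)
Definition rectangles (G : set (set Omega)) : set (set (Omega * ('I_D -> R))) :=
  [set A | exists (A1 : set Omega) (B : 'I_D -> set R),
     [/\ G A1, forall r, measurable (B r) &
         A = [set p | A1 p.1 /\ forall r, B r (p.2 r)]]].

Variables (G : set (set Omega)) (sG : sigma_algebra [set: Omega] G).

Lemma sigma_algebra_setI A B : G A -> G B -> G (A `&` B).
Proof.
move=> GA GB; rewrite -(sigma_algebra_id sG) in GA GB *.
exact: (@measurableI _ (g_sigma_algebraType G)).
Qed.

Lemma sigma_algebra_setT : G [set: Omega].
Proof. by rewrite -(sigma_algebra_id sG); exact: (@measurableT _ (g_sigma_algebraType G)). Qed.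

Lemma rectangles_setI : setI_closed (rectangles G).
Proof.
move=> _ _ [A1 [B [GA1 mB ->]]] [A1' [B' [GA1' mB' ->]]].
exists (A1 `&` A1'), (fun r => B r `&` B' r); split.
- exact: sigma_algebra_setI.
- by move=> r; exact: measurableI.
- apply/seteqP; split => [p [[? H] [? H']]|p [[? ?] H]] /=.
    by split.
  by split; split => // r; case: (H r).
Qed.

Lemma measurable_fst_rectangles (U : Omega -> R) :
  (forall B, measurable B -> G (U @^-1` B)) ->
  measurable_fun [set: g_sigma_algebraType (rectangles G)] (fun p => U p.1).
Proof.
move=> GU _ B mB; rewrite setTI; apply: sub_sigma_algebra.
exists (U @^-1` B), (fun=> setT); split => //; first exact: GU.
by apply/seteqP; split => p //= [].
Qed.

Lemma measurable_snd_rectangles (psi : R -> R) (r : 'I_D) :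
  measurable_fun [set: R] psi ->
  measurable_fun [set: g_sigma_algebraType (rectangles G)] (fun p => psi (p.2 r)).
Proof.
move=> mpsi _ B mB; rewrite setTI; apply: sub_sigma_algebra.
exists setT, (fun r' => if r' == r then psi @^-1` B else setT); split => //.
- exact: sigma_algebra_setT.
- by move=> r'; case: ifP => // _; rewrite -[_ @^-1` _]setTI; exact: mpsi.
- apply/seteqP; split => p /= => [Bp|[_ /(_ r)]]; last by rewrite eqxx.
  by split => // r'; case: eqP => // ->.
Qed.

(* Flipping the signs of all the [X r] does not change their joint law with [G]. *)
Lemma odd_expectation_eq0 (P : probability Omega R) (X : 'I_D -> Omega -> R)
    (Phi : Omega * ('I_D -> R) -> R) (K : R) :
  G `<=` measurable ->
  (forall r, measurable_fun [set: Omega] (X r)) ->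
  (forall A (B : 'I_D -> set R), G A -> (forall r, measurable (B r)) ->
    P (A `&` \bigcap_r [set w | B r (X r w)]) =
    (P A * \prod_(r < D) P [set w | B r (X r w)])%E) ->
  (forall r B, measurable B -> P [set w | B (- X r w)] = P [set w | B (X r w)]) ->
  measurable_fun [set: g_sigma_algebraType (rectangles G)] Phi ->
  (forall p, `|Phi p| <= K) ->
  (forall w x, Phi (w, fun r => - x r) = - Phi (w, x)) ->
  \int[P]_w Phi (w, fun r => X r w) = 0.
Proof.
move=> GM mX ind sym mPhi bPhi oddPhi.
have mpair (Z : 'I_D -> Omega -> R) : (forall r, measurable_fun [set: Omega] (Z r)) ->
    measurable_fun [set: Omega]
      ((fun w => (w, fun r => Z r w)) : Omega -> g_sigma_algebraType (rectangles G)).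
  move=> mZ; apply: (@measurability _ _ _ (g_sigma_algebraType (rectangles G)) _ _
    (rectangles G) erefl) => _ [_ [A1 [B [GA1 mB ->]]] <-].
  rewrite setTI (_ : _ @^-1` _ = A1 `&` \bigcap_r (Z r @^-1` B r)).
    apply: measurableI; first exact: GM.
    apply: fin_bigcap_measurable => // r _.
    by rewrite -[_ @^-1` _]setTI; exact: mZ.
  by apply/seteqP; split => w [? H]; split => // r; [move=> _|]; exact: H.
have mXN r : measurable_fun [set: Omega] (fun w => - X r w).
  exact: measurableT_comp.
pose TR := g_sigma_algebraType (rectangles G).
pose phi1 : Omega -> TR := fun w => (w, fun r => X r w).
pose phi2 : Omega -> TR := fun w => (w, fun r => - X r w).
pose mix1 := isMeasurableFun.Build _ _ _ _ phi1 (mpair X mX).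
pose f1 : {mfun Omega >-> TR} := HB.pack phi1 mix1.
pose mix2 := isMeasurableFun.Build _ _ _ _ phi2 (mpair _ mXN).
pose f2 : {mfun Omega >-> TR} := HB.pack phi2 mix2.
have mint (f : {mfun Omega >-> g_sigma_algebraType (rectangles G)}) :
    P.-integrable [set: Omega] (EFin \o (Phi \o f)).
  apply: measurable_bounded_integrable => //.
  - by rewrite (le_lt_trans (probability_le1 _ _)) ?ltry.
  - exact: (measurableT_comp mPhi (@measurable_funPT _ _ _ _ f)).
  - exists K; split; first by rewrite ger0_real// (le_trans _ (bPhi (point, fun=> 0))).
    by move=> x Kx w _ /=; rewrite (le_trans (bPhi _))// ltW.
(* The two laws agree on rectangles by independence and symmetry, hence everywhere by uniqueness of
   measures on a pi-system. *)
have dist12 A : measurable A -> distribution P f1 A = distribution P f2 A.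
  apply: (@measure_unique _ R TR (rectangles G) (fun=> setT) erefl).
  - exact: rectangles_setI.
  - move=> _; exists setT, (fun=> setT); split => //.
      exact: sigma_algebra_setT.
    by apply/seteqP; split.
  - by rewrite bigcup_const.
  - move=> _ [A1 [B [GA1 mB ->]]]; rewrite /distribution /pushforward.
    rewrite [X in P X = _](_ : _ = A1 `&` \bigcap_r [set w | B r (X r w)]); last first.
      by apply/seteqP; split => w [? H]; split => // r; [move=> _|]; exact: H.
    rewrite [X in _ = P X](_ : _ =
        A1 `&` \bigcap_r [set w | (fun x => B r (- x)) (X r w)]); last first.
      by apply/seteqP; split => w [? H]; split => // r; [move=> _|]; exact: H.
    have mBN r : measurable (fun x : R => B r (- x)).
      rewrite [X in measurable X](_ : _ = (-%R : R -> R) @^-1` B r)// -[_ @^-1` _]setTI.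
      by apply: oppr_measurable.
    rewrite ind// [RHS](ind A1 (fun r => [set x | B r (- x)]))//.
    congr (_ * _)%E; apply: eq_bigr => r _.
    exact: esym (sym r (B r) (mB r)).
  - by move=> _; rewrite (le_lt_trans (probability_le1 _ _)) ?ltry.
have E1 : \int[P]_w Phi (f1 w) = \int[P]_w Phi (f2 w).
  rewrite /Rintegral; congr fine.
  have := @integral_pushforward _ _ _ _ R f1 (@measurable_funPT _ _ _ _ f1)
    P setT (EFin \o Phi).
  rewrite preimage_setT => <- //; last 2 first.
    by apply/measurable_EFinP.
    exact: mint.
  have := @integral_pushforward _ _ _ _ R f2 (@measurable_funPT _ _ _ _ f2)
    P setT (EFin \o Phi).
  rewrite preimage_setT => <- //; last 2 first.
    by apply/measurable_EFinP.
    exact: mint.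
  by apply: (eq_measure_integral (distribution P f2)) => A mA _; exact: dist12.
have E2 : \int[P]_w Phi (f2 w) = - \int[P]_w Phi (f1 w).
  rewrite -mulN1r -RintegralZl//; last exact: mint.
  by apply: eq_Rintegral => w _; rewrite /= oddPhi mulN1r.
rewrite -[LHS]/(\int[P]_w Phi (f1 w)).
by move: E2; rewrite -E1; lra.
Qed.

End odd_expectation.

(** * Gaussian moments *)

Section gaussian.
Context {R : realType}.
Local Notation mu := (@lebesgue_measure R).

(** The density is almost everywhere the Radon-Nikodym derivative, as both have the same integral
    over every measurable set. *)
Lemma integral_normal_prob (s : R) (f : R -> \bar R) :
  measurable_fun [set: R] f -> (forall x, 0 <= f x)%E ->
  (\int[normal_prob 0 s]_x f x = \int[mu]_x (f x * (normal_pdf 0 s x)%:E))%E.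
Proof.
move=> mf f0; have dom := normal_prob_dominates 0 s.
rewrite -(Radon_Nikodym_SigmaFinite.change_of_variables dom)//.
have mpdf : measurable_fun [set: R] (fun x => (normal_pdf 0 s x)%:E).
  by apply/measurable_EFinP; exact: measurable_normal_pdf.
have intRN := Radon_Nikodym_SigmaFinite.f_integrable dom.
apply: ae_eq_integral => //.
- by apply: emeasurable_funM => //; exact: (measurable_int mu).
- exact: emeasurable_funM.
- apply: ae_eqe_mul2l; apply: integral_ae_eq => // A _ mA.
  by rewrite -Radon_Nikodym_SigmaFinite.f_integral.
Qed.

Lemma normal_prob_sym (s : R) (B : set R) : s != 0 -> measurable B ->
  normal_prob 0 s [set x | B (- x)] = normal_prob 0 s B.
Proof.
move=> s0 mB; rewrite /normal_prob.
have mN : measurable_fun [set: R] (-%R : R -> measurableTypeR R) by exact: oppr_measurable.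
have -> : (\int[mu]_(x in B) (normal_pdf 0 s x)%:E =
    \int[pushforward mu (-%R : R -> measurableTypeR R)]_(x in B) (normal_pdf 0 s x)%:E)%E.
  apply: eq_measure_integral => A mA _; exact: esym (lebesgue_measureN mA).
rewrite ge0_integral_pushforward//.
- apply: eq_integral => x _ /=; rewrite !normal_pdfE// /normal_fun !subr0.
  by rewrite sqrrN.
- by apply/measurable_funTS/measurable_EFinP; exact: measurable_normal_pdf.
- by move=> x _; rewrite lee_fin normal_pdf_ge0.
Qed.

(* Against [exp (x^2 / 4 s^2)], the density of N(0, s^2) becomes [sqrt 2] times
   that of N(0, 2 s^2). *)
Lemma integral_expR_normal (s : R) : 0 < s ->
  (\int[normal_prob 0 s]_x (expR (x ^+ 2 / (4 * s ^+ 2)))%:E = (Num.sqrt 2)%:E)%E.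
Proof.
move=> s0; have s20 : 0 < Num.sqrt 2 * s by rewrite mulr_gt0// sqrtr_gt0.
have m1 : measurable_fun [set: R] (fun x : R => (expR (x ^+ 2 / (4 * s ^+ 2)))%:E).
  apply/measurable_EFinP; apply: measurableT_comp => //.
  by apply: measurable_funM => //; apply: measurable_funX.
rewrite integral_normal_prob//.
transitivity (\int[mu]_x ((Num.sqrt 2)%:E * (normal_pdf 0 (Num.sqrt 2 * s) x)%:E))%E.
  apply: eq_integral => x _; rewrite -!EFinM; congr EFin.
  rewrite !normal_pdfE ?gt_eqF//.
  rewrite /normal_fun !subr0 /normal_peak exprMn sqr_sqrtr//.
  have -> : expR (x ^+ 2 / (4 * s ^+ 2)) * ((Num.sqrt (s ^+ 2 * pi *+ 2))^-1 *
      expR (- x ^+ 2 / (s ^+ 2 *+ 2))) =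
      (Num.sqrt (s ^+ 2 * pi *+ 2))^-1 * expR (- x ^+ 2 / (2 * s ^+ 2 *+ 2)).
    rewrite mulrCA -expRD; congr (_ * expR _).
    by field; rewrite gt_eqF.
  rewrite [RHS]mulrA; congr (_ * _).
  have -> : 2 * s ^+ 2 * pi *+ 2 = 2 * (s ^+ 2 * pi *+ 2) by ring.
  rewrite sqrtrM// invfM mulrA divff ?mul1r// gt_eqF// sqrtr_gt0//.
rewrite ge0_integralZl_EFin//.
- by rewrite integral_normal_pdf mule1.
- by move=> x _; rewrite lee_fin normal_pdf_ge0.
- by apply/measurable_EFinP; exact: measurable_normal_pdf.
Qed.

(** With [y = x ^+ 2 / (4 * s ^+ 2)], the bound [y ^+ k <= k! * exp y] reduces all even moments to
    one exponential integral, of value [sqrt 2]. *)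
Lemma normal_even_moment_le (d : measure_display) (Omega : measurableType d)
    (P : probability Omega R) (X : Omega -> R) (s : R) (k : nat) : 0 < s ->
  measurable_fun [set: Omega] X ->
  (forall B, measurable B -> P [set w | B (X w)] = normal_prob 0 s B) ->
  (\int[P]_w (X w ^+ k.*2)%:E <= (Num.sqrt 2 * k`!%:R * 4 ^+ k * s ^+ k.*2)%:E)%E.
Proof.
move=> s0 mX lawX.
have mX' : measurable_fun [set: Omega] (X : Omega -> measurableTypeR R) by [].
pose X0 : Omega -> measurableTypeR R := X.
pose mix := isMeasurableFun.Build _ _ _ _ X0 mX'.
pose X' : {mfun Omega >-> measurableTypeR R} := HB.pack X0 mix.
have m2 : measurable_fun [set: R] (fun x : R => (x ^+ k.*2)%:E).
  by apply/measurable_EFinP; apply: measurable_funX.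
have m1 : measurable_fun [set: R] (fun x : R => (expR (x ^+ 2 / (4 * s ^+ 2)))%:E).
  apply/measurable_EFinP; apply: measurableT_comp => //.
  by apply: measurable_funM => //; apply: measurable_funX.
have even0 (x : R) : 0 <= x ^+ k.*2 by rewrite -mul2n exprM exprn_ge0// sqr_ge0.
have -> : (\int[P]_w (X w ^+ k.*2)%:E = \int[normal_prob 0 s]_x (x ^+ k.*2)%:E)%E.
  have <- := @ge0_integral_distribution _ _ _ _ _ P X' (fun x => (x ^+ k.*2)%:E).
  - by apply: (eq_measure_integral (normal_prob 0 s)) => A mA _; exact: lawX.
  - exact: m2.
  - by move=> x; rewrite lee_fin.
apply: (@le_trans _ _ (\int[normal_prob 0 s]_x
    ((k`!%:R * 4 ^+ k * s ^+ k.*2)%:E * (expR (x ^+ 2 / (4 * s ^+ 2)))%:E))%E).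
  apply: ge0_le_integral => //.
  - by move=> x _; rewrite lee_fin.
  - exact: measurable_funeM.
  - move=> x _; rewrite lee_fin.
    set y := x ^+ 2 / (4 * s ^+ 2).
    have y0 : 0 <= y by rewrite divr_ge0 ?sqr_ge0// mulr_ge0// sqr_ge0.
    have -> : x ^+ k.*2 = 4 ^+ k * s ^+ k.*2 * y ^+ k.
      rewrite -!mul2n !exprM -exprMn -exprMn /y mulrC divfK//.
      by rewrite mulf_neq0// sqrf_eq0 gt_eqF.
    have yk : y ^+ k <= k`!%:R * expR y.
      have [->|k0] := posnP k.
        by rewrite expr0 fact0 mul1r (le_trans _ (expR_ge1Dx y))// lerDl.
      rewrite mulrC -ler_pdivrMr ?ltr0n ?fact_gt0//.
      by have := expR_ge1Dxn k.-1 y0; rewrite prednK//; lra.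
    have c0 : 0 <= 4 ^+ k * s ^+ k.*2 by rewrite mulr_ge0// exprn_ge0// ltW.
    by rewrite (le_trans (ler_wpM2l c0 yk))// le_eqVlt; apply/orP; left; apply/eqP; ring.
have c0 : 0 <= k`!%:R * 4 ^+ k * s ^+ k.*2 by rewrite !mulr_ge0// exprn_ge0// ltW.
rewrite ge0_integralZl_EFin// integral_expR_normal// -EFinM lee_fin.
by rewrite le_eqVlt; apply/orP; left; apply/eqP; ring.
Qed.

End gaussian.

(** * Truncated increments and the energy recursion *)

Section probability_tools.
Context {R : realType}.

Lemma power_sum_le (D n : nat) (a0 : R) (a : 'I_D -> R) : 0 <= a0 -> (forall r, 0 <= a r) ->
  (a0 + \sum_r a r) ^+ n <= D.+1%:R ^+ n * (a0 ^+ n + \sum_r a r ^+ n).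
Proof.
move=> a00 a_ge0; pose mx := \big[Num.max/a0]_r a r.
have amx r : a r <= mx by exact: (le_bigmax _ a r).
have a0mx : a0 <= mx by exact: bigmax_ge_id.
have sum_ge0 : 0 <= \sum_r a r ^+ n by apply: sumr_ge0 => r _; rewrite exprn_ge0.
have mxn : mx ^+ n <= a0 ^+ n + \sum_r a r ^+ n.
  rewrite /mx; elim/big_ind : _ => [|x y xS yS|r _]; first by rewrite lerDl.
    by rewrite maxEle; case: ifP.
  rewrite (bigD1 r)//= addrCA lerDl addr_ge0 ?exprn_ge0//.
  by apply: sumr_ge0 => k _; rewrite exprn_ge0.
rewrite (@le_trans _ _ ((D.+1%:R * mx) ^+ n))//.
  rewrite lerXn2r ?nnegrE ?addr_ge0 ?sumr_ge0// ?mulr_ge0// ?(le_trans a00)//.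
  rewrite -nat1r mulrDl mul1r lerD//.
  rewrite (le_trans (ler_sum _ (fun r _ => amx r)))//.
  by rewrite sumr_const card_ord mulr_natl.
by rewrite exprMn ler_wpM2l// exprn_ge0.
Qed.

(** [C] is fixed before the variables and before [s], later [sqrt h], so the final constant does not
    depend on [h]. *)
Lemma noise_moment_le (D k : nat) : exists2 C : R, 0 <= C &
  forall (d : measure_display) (Omega : measurableType d) (P : probability Omega R)
    (X : 'I_D -> Omega -> R) (s : R), 0 < s ->
  (forall r, measurable_fun [set: Omega] (X r)) ->
  (forall r B, measurable B -> P [set w | B (X r w)] = normal_prob 0 s B) ->
  (\int[P]_w ((s + \sum_r `|X r w|) ^+ k.*2)%:E <= (C * s ^+ k.*2)%:E)%E.
Proof.
pose C1 : R := Num.sqrt 2 * k`!%:R * 4 ^+ k.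
have C10 : 0 <= C1 by rewrite !mulr_ge0// exprn_ge0.
have D0 : 0 <= D.+1%:R ^+ k.*2 :> R by rewrite exprn_ge0.
exists (D.+1%:R ^+ k.*2 * (1 + D%:R * C1)) => [|d Omega P X s s0 mX lawX].
  by rewrite mulr_ge0// addr_ge0// mulr_ge0.
have mpow r : measurable_fun [set: Omega] (fun w => `|X r w| ^+ k.*2).
  by apply: measurable_funX; exact: measurableT_comp.
apply: (@le_trans _ _ (\int[P]_w ((D.+1%:R ^+ k.*2)%:E *
    ((s ^+ k.*2)%:E + \sum_(r < D) (`|X r w| ^+ k.*2)%:E)))%E).
  apply: ge0_le_integral => //.
  - move=> w _; rewrite lee_fin exprn_ge0// addr_ge0 ?sumr_ge0// ltW//.
  - apply/measurable_EFinP; apply: measurable_funX; apply: measurable_funD => //.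
    by apply: measurable_sum => r; exact: measurableT_comp.
  - apply: measurable_funeM; apply: emeasurable_funD => //.
    by apply: emeasurable_sum => r; exact/measurable_EFinP.
  - by move=> w _; rewrite sumEFin -EFinD -EFinM lee_fin power_sum_le// ltW.
rewrite ge0_integralZl_EFin//; last 2 first.
- by move=> w _; rewrite sumEFin -EFinD lee_fin addr_ge0 ?exprn_ge0 ?sumr_ge0// ?ltW// => r _;
    rewrite exprn_ge0.
- by apply: emeasurable_funD => //; apply: emeasurable_sum => r; exact/measurable_EFinP.
rewrite ge0_integralD//; last 3 first.
- by move=> w _; rewrite lee_fin exprn_ge0// ltW.
- by move=> w _; rewrite sumEFin lee_fin sumr_ge0// => r _; rewrite exprn_ge0.
- by apply: emeasurable_sum => r; exact/measurable_EFinP.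
rewrite integral_cst//= probability_setT mule1 ge0_integral_sum//; last first.
  by move=> r; exact/measurable_EFinP.
rewrite -mulrA EFinM lee_wpmul2l ?lee_fin// mulrDl mul1r EFinD leeD2l//.
apply: (@le_trans _ _ (\sum_(r < D) (C1 * s ^+ k.*2)%:E)%E).
  apply: lee_sum => r _.
  have := normal_even_moment_le k s0 (mX r) (lawX r).
  congr (_ <= _)%E; apply: eq_integral => w _; congr EFin.
  by rewrite -mul2n !exprM real_normK ?num_real.
by rewrite sumEFin lee_fin sumr_const card_ord -mulrA mulr_natl.
Qed.

(** In this form truncation is visibly monotone, hence measurable. *)
Lemma truncateE (A x : R) : 0 <= A -> truncate A x = Num.max (- A) (Num.min A x).
Proof.
move=> A0; rewrite /truncate; case: (leP `|x| A) => [|Ax].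
  by rewrite ler_norml => /andP[? ?]; rewrite min_r// max_r.
have [xA|xA] := ltP A x; first by rewrite max_r// (le_trans _ A0) ?oppr_le0.
rewrite max_l// leNgt; apply/negP => Axx.
by move: Ax; rewrite ltNge ler_norml xA ltW.
Qed.

Lemma truncateN (A x : R) : 0 <= A -> truncate A (- x) = - truncate A x.
Proof.
move=> A0; rewrite /truncate normrN; case: (leP `|x| A) => // Ax.
have [x0|x0] := leP 0 x.
  move: Ax; rewrite ger0_norm// => ->.
  by rewrite ltNge (le_trans _ A0)//= oppr_le0.
move: Ax; rewrite ltr0_norm// => ->.
by rewrite ltNge (le_trans (ltW x0) A0)/= opprK.
Qed.

Lemma norm_truncate_le (A x : R) : 0 <= A -> `|truncate A x| <= A.
Proof.
move=> A0; rewrite /truncate; case: (leP `|x| A) => // _.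
by case: ifP => _; rewrite ?normrN ger0_norm.
Qed.

Lemma norm_truncate_le_norm (A x : R) : 0 <= A -> `|truncate A x| <= `|x|.
Proof.
move=> A0; rewrite /truncate; case: (leP `|x| A) => // /ltW Ax.
by case: ifP => _; rewrite ?normrN (ger0_norm A0).
Qed.

Lemma measurable_truncate (A : R) : 0 <= A -> measurable_fun [set: R] (truncate A).
Proof.
move=> A0; apply: nondecreasing_measurable => // x y xy.
rewrite !truncateE// ge_max le_max lexx/= le_max; apply/orP; right.
by rewrite le_min ge_min lexx/= ge_min xy orbT.
Qed.

(** With [t = h ^ (1/4)], [|ln h| <= 2 / t ^+ 2], so [h * 4 |ln h| <= 8 * t ^+ 2] and the threshold
    is at most [3 * t]; hence the fourth power in the choice of [h0]. *)
Lemma truncation_threshold_small (D : nat) (delta : R) : 0 < delta ->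
  exists2 h0 : R, 0 < h0 <= 1 & forall h, 0 < h -> h <= h0 ->
    h + D%:R * (Num.sqrt h * Num.sqrt (4 * `|ln h|)) <= delta.
Proof.
move=> delta0; pose e := Num.min 1 (delta / (1 + 3 * D%:R)).
have D3 : 0 < 1 + 3 * D%:R :> R by rewrite ltr_pwDl// mulr_ge0.
have e0 : 0 < e by rewrite lt_min ltr01 divr_gt0.
have e1 : e <= 1 by rewrite ge_min lexx.
exists (e ^+ 4); first by rewrite exprn_gt0//= exprn_ile1// ltW.
move=> h h_gt0 hh0.
have h1 : h <= 1 by rewrite (le_trans hh0)// exprn_ile1// ltW.
pose t := Num.sqrt (Num.sqrt h).
have sh0 : 0 < Num.sqrt h by rewrite sqrtr_gt0.
have t0 : 0 < t by rewrite !sqrtr_gt0.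
have t2 : t ^+ 2 = Num.sqrt h by rewrite sqr_sqrtr// ltW.
have t4 : t ^+ 4 = h by rewrite (exprM t 2 2) t2 sqr_sqrtr// ltW.
have te : t <= e.
  by rewrite -(ler_pXn2r (ltn0Sn 3)) ?nnegrE ?(ltW t0) ?(ltW e0)// t4.
have t1 : t <= 1 by exact: le_trans te e1.
have th : h <= t by rewrite -t4 exprS ler_piMr ?(ltW t0)// exprn_ile1// ltW.
have lnh : `|ln h| <= 2 / t ^+ 2.
  rewrite ler0_norm ?ln_le0// -{1}t4 (exprM t 2 2) lnXn ?exprn_gt0//.
  rewrite -mulNrn -lnV ?posrE ?exprn_gt0// -[leLHS]mulr_natl ler_wpM2l//.
  by rewrite ltW// ln_sublinear// invr_gt0 exprn_gt0.
have sqh : Num.sqrt h * Num.sqrt (4 * `|ln h|) <= 3 * t.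
  have -> : 3 * t = Num.sqrt ((3 * t) ^+ 2).
    by rewrite sqrtr_sqr ger0_norm// mulr_ge0// ltW.
  rewrite -sqrtrM ?(ltW h_gt0)//; apply: ler_wsqrtr.
  apply: (@le_trans _ _ (h * (4 * (2 / t ^+ 2)))).
    by rewrite !ler_wpM2l// ltW.
  rewrite -t4 exprMn; have -> : t ^+ 4 * (4 * (2 / t ^+ 2)) = 8 * t ^+ 2.
    by field; rewrite gt_eqF.
  have := sqr_ge0 t; lra.
have tD : t * (1 + 3 * D%:R) <= delta.
  by rewrite -ler_pdivlMr// (le_trans te)// ge_min lexx orbT.
have := ler_wpM2l (ler0n R D) sqh; lra.
Qed.

Lemma discrete_gronwall (e : nat -> R) (h C : R) (N : nat) :
  0 <= h -> 0 <= C -> e 0%N <= 0 ->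
  (forall n, (n < N)%N -> e n.+1 <= (1 + h) * e n + C * h) ->
  e N <= C * (N%:R * h) * expR (N%:R * h).
Proof.
move=> h0 C0 e0 eS.
(* This form passes through the induction because [(1 + h) ^+ n.+1 >= 1] absorbs the new term
   [C * h]. *)
have H n : (n <= N)%N -> e n <= C * (n%:R * h) * (1 + h) ^+ n.
  elim: n => [|n IH] nN; first by rewrite mul0r mulr0 mul0r.
  have h1 : 0 <= 1 + h by rewrite addr_ge0.
  rewrite (le_trans (eS n nN))//.
  rewrite (le_trans (lerD (ler_wpM2l h1 (IH (ltnW nN))) (lexx _)))//.
  have p1 : 1 <= (1 + h) ^+ n.+1 by rewrite exprn_ege1// lerDl.
  have := ler_wpM2l (mulr_ge0 C0 h0) p1.
  rewrite -natr1 exprS; lra.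
rewrite (le_trans (H N _))//.
rewrite ler_wpM2l ?mulr_ge0// expRM_natl lerXn2r ?nnegrE ?expR_ge0 ?addr_ge0//.
exact: expR_ge1Dx.
Qed.

Section bounded_expectation.
Context {d : measure_display} {Omega : measurableType d} (P : probability Omega R).

(** For fixed [h] truncation bounds each change of the potential, so all variables of the recursion
    are of this kind and integrable. *)
Definition bounded_rv (X : Omega -> R) :=
  measurable_fun [set: Omega] X /\ exists K, forall w, `|X w| <= K.

Lemma bounded_rv_integrable X : bounded_rv X -> P.-integrable [set: Omega] (EFin \o X).
Proof.
move=> [mX [K HK]]; apply: measurable_bounded_integrable => //.
  by rewrite (le_lt_trans (probability_le1 _ _)) ?ltry.
exists K; split; first by rewrite ger0_real// (le_trans _ (HK point)).
by move=> x Kx w _ /=; rewrite (le_trans (HK _))// ltW.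
Qed.

Lemma bounded_rvD X Y : bounded_rv X -> bounded_rv Y -> bounded_rv (X \+ Y).
Proof.
move=> [mX [K HK]] [mY [K' HK']]; split; first exact: measurable_funD.
by exists (K + K') => w; rewrite (le_trans (ler_normD _ _))// lerD.
Qed.

Lemma bounded_rvM X Y : bounded_rv X -> bounded_rv Y -> bounded_rv (X \* Y).
Proof.
move=> [mX [K HK]] [mY [K' HK']]; split; first exact: measurable_funM.
by exists (K * K') => w; rewrite normrM ler_pM.
Qed.

Lemma bounded_rvZ k X : bounded_rv X -> bounded_rv (fun w => k * X w).
Proof.
move=> [mX [K HK]]; split; first exact: measurable_funM.
by exists (`|k| * K) => w; rewrite normrM ler_wpM2l.
Qed.

(* [2 V Q <= h V^2 + Q^2 / h] turns the small non-centred part [Q] into an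
   [O(h)] relative perturbation of [E V^2]. *)
Lemma energy_step (V Mt Q : Omega -> R) (h cM cQ : R) : 0 < h -> h <= 1 ->
  bounded_rv V -> bounded_rv Mt -> bounded_rv Q ->
  \int[P]_w (V w * Mt w) = 0 ->
  \int[P]_w (Mt w ^+ 2) <= cM -> \int[P]_w (Q w ^+ 2) <= cQ * h ->
  0 <= cQ ->
  \int[P]_w ((V w + Mt w + Q w) ^+ 2) <=
    (1 + h) * \int[P]_w (V w ^+ 2) + (2 * cM + 3 * cQ).
Proof.
move=> h0 h1 bV bM bQ VM0 M2 Q2 cQ0.
have int X : bounded_rv X -> P.-integrable [set: Omega] (EFin \o X).
  exact: bounded_rv_integrable.
have bsq X : bounded_rv X -> bounded_rv (fun w => X w ^+ 2).
  by move=> ?; exact: bounded_rvM.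
have bVM := bounded_rvM bV bM.
have b1 := bounded_rvZ (1 + h) (bsq _ bV).
have b2 := bounded_rvZ 2 bVM.
have b3 := bounded_rvZ 2 (bsq _ bM).
have b4 := bounded_rvZ (2 + h^-1) (bsq _ bQ).
have b12 := bounded_rvD b1 b2.
have b123 := bounded_rvD b12 b3.
have b1234 := bounded_rvD b123 b4.
apply: (@le_trans _ _ (\int[P]_w ((1 + h) * V w ^+ 2 + 2 * (V w * Mt w) +
    2 * Mt w ^+ 2 + (2 + h^-1) * Q w ^+ 2))).
  apply: le_Rintegral => //.
  - apply: int; apply: bsq; exact: bounded_rvD (bounded_rvD bV bM) bQ.
  - exact: (int _ b1234).
  - move=> w _.
    have hV : 2 * (V w * Q w) <= h * V w ^+ 2 + h^-1 * Q w ^+ 2.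
      have : 0 <= h^-1 * (h * V w - Q w) ^+ 2 by rewrite mulr_ge0 ?invr_ge0 ?sqr_ge0// ltW.
      have -> : h^-1 * (h * V w - Q w) ^+ 2 =
          h * V w ^+ 2 - 2 * (V w * Q w) + h^-1 * Q w ^+ 2.
        by field; rewrite gt_eqF.
      lra.
    (* [2 M Q <= M^2 + Q^2] explains the weights [2] and [2 + h^-1]; as [h <= 1], the latter costs
       [3 * cQ] against [E Q^2 <= cQ * h]. *)
    have := sqr_ge0 (Mt w - Q w); move: hV; set hi := h^-1; nra.
rewrite (RintegralD measurableT (int _ b123) (int _ b4)).
rewrite (RintegralD measurableT (int _ b12) (int _ b3)).
rewrite (RintegralD measurableT (int _ b1) (int _ b2)).
rewrite (RintegralZl _ measurableT (int _ (bsq _ bV))).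
rewrite (RintegralZl _ measurableT (int _ bVM)).
rewrite (RintegralZl _ measurableT (int _ (bsq _ bM))).
rewrite (RintegralZl _ measurableT (int _ (bsq _ bQ))).
rewrite VM0 mulr0 addr0 -[leLHS]addrA lerD2l lerD// ?ler_wpM2l//.
have hi0 : 0 <= 2 + h^-1 by rewrite addr_ge0// invr_ge0 ltW.
rewrite (le_trans (ler_wpM2l hi0 Q2))// mulrDl.
have -> : h^-1 * (cQ * h) = cQ by field; rewrite gt_eqF.
have := ler_wpM2l cQ0 h1; lra.
Qed.

End bounded_expectation.

End probability_tools.

(** * Vector form of the measurability criterion, and second moments *)

Section vector_lipschitz_measurability.
Context {R : realType}.

Lemma ler_exprn n (x1 x2 : R) : 0 <= x1 -> x1 <= x2 -> x1 ^+ n <= x2 ^+ n.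
Proof. by move=> x10 x12; rewrite lerXn2r// nnegrE// (le_trans x10). Qed.

Lemma norm_le_sum_coord n (v : 'cV[R]_n) : `|v| <= \sum_j `|v j 0|.
Proof.
apply: mx_norm_le => [|i j]; first exact: sumr_ge0.
by rewrite (ord1 j) (bigD1 i)//= lerDl sumr_ge0.
Qed.

Lemma vector_lipschitz_measurable (m D : nat) (d : measure_display)
    (T : measurableType d) (Y : T -> 'cV[R]_m) (Z : 'I_D -> T -> R) (X : T -> R)
    (A0 : set T) (C : R) :
  (forall j, measurable_fun [set: T] (fun w => Y w j 0)) ->
  (forall r, measurable_fun [set: T] (Z r)) ->
  (forall A, A `<=` ~` A0 -> measurable A) -> 0 <= C ->
  (forall w w', A0 w -> A0 w' ->
    `|X w - X w'| <= C * (`|Y w - Y w'| + \sum_r `|Z r w - Z r w'|)) ->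
  measurable_fun [set: T] X.
Proof.
move=> mY mZ mA0 C0 HX.
pose U (i : 'I_m + 'I_D) w := match i with inl j => Y w j 0 | inr r => Z r w end.
apply: (@lipschitz_in_measurable _ _ _ _ U _ A0 C) => //.
  by case => [j|r]; [exact: mY|exact: mZ].
move=> w w' Aw Aw'; rewrite (le_trans (HX w w' Aw Aw'))// ler_wpM2l//.
rewrite big_sumType/= lerD2r (le_trans (norm_le_sum_coord _))//.
by apply: ler_sum => j _; rewrite !mxE.
Qed.

Lemma second_moment_le (D k : nat) (d : measure_display) (Omega : measurableType d)
    (P : probability Omega R) (X : Omega -> R) (U : 'I_D -> Omega -> R) (s K C : R) :
  0 <= s -> measurable_fun [set: Omega] X ->
  (forall r, measurable_fun [set: Omega] (U r)) ->
  (forall w, `|X w| <= K * (s + \sum_r `|U r w|) ^+ k) ->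
  (\int[P]_w ((s + \sum_r `|U r w|) ^+ k.*2)%:E <= C%:E)%E ->
  \int[P]_w (X w ^+ 2) <= K ^+ 2 * C.
Proof.
move=> s0 mX mU XK H.
have mrho : measurable_fun [set: Omega] (fun w => (s + \sum_r `|U r w|) ^+ k.*2).
  apply: measurable_funX; apply: measurable_funD => //.
  by apply: measurable_sum => r; exact: measurableT_comp.
have rho0 w : 0 <= s + \sum_r `|U r w| by rewrite addr_ge0 ?sumr_ge0.
have X0 : (0 <= \int[P]_w (X w ^+ 2)%:E)%E.
  by apply: integral_ge0 => w _; rewrite lee_fin sqr_ge0.
have XC : (\int[P]_w (X w ^+ 2)%:E <= (K ^+ 2 * C)%:E)%E.
  apply: (@le_trans _ _ (\int[P]_w
      ((K ^+ 2)%:E * ((s + \sum_r `|U r w|) ^+ k.*2)%:E))%E).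
    apply: ge0_le_integral => //.
    - by move=> w _; rewrite lee_fin sqr_ge0.
    - by apply/measurable_EFinP; exact: measurable_funX.
    - by apply: measurable_funeM; exact/measurable_EFinP.
    - move=> w _; rewrite -EFinM lee_fin -[X w ^+ 2]real_normK ?num_real//.
      rewrite -muln2 exprM -exprMn lerXn2r ?nnegrE// (le_trans _ (XK w))//.
  rewrite ge0_integralZl_EFin ?sqr_ge0//.
  - by rewrite [leRHS]EFinM lee_wpmul2l// lee_fin sqr_ge0.
  - by move=> w _; rewrite lee_fin exprn_ge0.
  - exact/measurable_EFinP.
rewrite /Rintegral -lee_fin fineK// ge0_fin_numE//.
by rewrite (le_lt_trans XC)// ltry.
Qed.

End vector_lipschitz_measurability.

(** * Paths of the scheme *)

Section scheme_paths.
Context {R : realType} {d : measure_display} {Omega : measurableType d}.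
Context {m nu D M : nat}.
Variables (P : probability Omega R) (T : R) (F : R -> set (set Omega)).
Variables (W : 'I_D -> R -> Omega -> R) (Y0 : Omega -> 'cV[R]_m).
Variables (f : 'cV[R]_m -> 'cV[R]_m) (g : 'I_D -> 'cV[R]_m -> 'cV[R]_m).
Variables (L : 'cV[R]_m -> 'cV[R]_nu) (c b : 'I_M -> R).
Variables (h : R) (N : nat) (y : nat -> Omega -> 'cV[R]_m).
Hypotheses (h0 : 0 < h) (hN : N%:R * h = T).
Hypotheses (usual_F : usual_filtration P T F) (brownian_W : brownian_motions P T F W).
Hypotheses (Y0_F0 : vec_measurable (F 0) Y0).
Hypotheses (scheme : mavf_scheme P L f g c b W Y0 h N y).

Let t (n : nat) : R := n%:R * h.

Let t_ge0 n : 0 <= t n. Proof. by rewrite mulr_ge0// ltW. Qed.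

Let t_lt n : t n < t n.+1. Proof. by rewrite ltr_pM2r// ltr_nat. Qed.

Let t_le n : (n <= N)%N -> t n <= T.
Proof. by move=> nN; rewrite -hN ler_pM2r// ler_nat. Qed.

Definition increment (n : nat) (r : 'I_D) (w : Omega) : R := W r (t n.+1) w - W r (t n) w.

Definition threshold : R := Num.sqrt h * Num.sqrt (4 * `|ln h|).

Definition truncation (x : R) : R :=
  Num.sqrt h * truncate (Num.sqrt (4 * `|ln h|)) (x / Num.sqrt h).

Let z n r w := truncation (increment n r w).

Lemma truncationN x : truncation (- x) = - truncation x.
Proof. by rewrite /truncation mulNr truncateN// mulrN. Qed.

Lemma norm_truncation_le x : `|truncation x| <= threshold.
Proof.
rewrite /truncation normrM ger0_norm ?sqrtr_ge0// ler_wpM2l ?sqrtr_ge0//.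
exact: norm_truncate_le.
Qed.

Lemma norm_truncation_le_norm x : `|truncation x| <= `|x|.
Proof.
have h1 : 0 < Num.sqrt h by rewrite sqrtr_gt0.
rewrite /truncation normrM ger0_norm ?sqrtr_ge0//.
rewrite (le_trans (ler_wpM2l (ltW h1) (norm_truncate_le_norm _ _)))//.
by rewrite normrM normfV (gtr0_norm h1) mulrC divfK// gt_eqF.
Qed.

Lemma measurable_truncation : measurable_fun [set: R] truncation.
Proof.
apply: measurable_funM => //.
apply: (@measurableT_comp _ _ _ _ _ _ (truncate (Num.sqrt (4 * `|ln h|)))).
  exact: measurable_truncate.
exact: measurable_funM.
Qed.

(** The scheme holds only almost surely. Every subset of the complement of [good] is negligible,
    hence in [F 0], so nothing that happens there affects adaptedness. *)
Definition good : set Omega := [set w | forall n, (n < N)%N ->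
  scheme_step c b (jac L) f g h (fun r => z n r w) (y n w) (y n.+1 w)].

Let F_sigma n : (n <= N)%N -> sigma_algebra [set: Omega] (F (t n)).
Proof.
by move=> nN; case: usual_F => H _ _ _; case: (H (t n)) => //; rewrite t_ge0 t_le.
Qed.

Let F_sub n : (n <= N)%N -> F (t n) `<=` measurable.
Proof.
by move=> nN; case: usual_F => H _ _ _; case: (H (t n)) => //; rewrite t_ge0 t_le.
Qed.

Let F_mono k n : (k <= n)%N -> (n <= N)%N -> F (t k) `<=` F (t n).
Proof.
move=> kn nN; case: usual_F => _ H _ _.
by apply: (H _ _ (t_ge0 k) _ (t_le nN)); rewrite ler_pM2r// ler_nat.
Qed.

Let t0 : t 0 = 0. Proof. by rewrite /t mul0r. Qed.

Lemma not_good_negligible : P.-negligible (~` good).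
Proof.
pose G n w := scheme_step c b (jac L) f g h (fun r => z n r w) (y n w) (y n.+1 w).
apply: (@negligibleS _ _ _ _ (\bigcup_k (if (k < N)%N then ~` [set w | G k w] else set0))).
  move=> w /= ngood.
  have [k /not_implyP[kN nG]] := (existsNP _).2 ngood.
  by exists k => //; rewrite kN.
apply: negligible_bigcup => k; case: ifPn => [kN|_]; last exact: negligible_set0.
case: scheme => _ _ /(_ k kN)[a0 [a [_ _ H1]]].
apply: (negligibleS _ H1) => w /= nG H2; apply: nG.
by exists (a0 w), (fun r => a r w).
Qed.

Lemma sub_not_good A : A `<=` ~` good -> forall n, (n <= N)%N -> F (t n) A.
Proof.
move=> Agood n nN; apply: (F_mono (leq0n n) nN); rewrite t0.
by case: usual_F => _ _ H _; apply: H; exact: negligibleS not_good_negligible.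
Qed.

Lemma measurable_good : measurable good.
Proof.
rewrite -[good]setCK; apply: measurableC.
by apply: (F_sub (leq0n N)); exact: sub_not_good.
Qed.

Lemma increment_adapted n r : (n < N)%N ->
  measurable_fun [set: g_sigma_algebraType (F (t n.+1))] (increment n r).
Proof.
move=> nN; case: brownian_W => aW _ _ _.
apply: measurable_funB; apply/(measurable_g_sigma_algebraP _ (F_sigma nN)) => B mB.
  by apply: aW => //; rewrite t_ge0 t_le.
apply: (F_mono (leqnSn n) nN).
by apply: aW => //; rewrite t_ge0 t_le// ltnW.
Qed.

Lemma measurable_increment n r : (n < N)%N -> measurable_fun [set: Omega] (increment n r).
Proof.
move=> nN _ B mB; rewrite setTI; apply: (F_sub nN).
exact: (measurable_g_sigma_algebraP _ (F_sigma nN)).2 (increment_adapted r nN) B mB.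
Qed.

Lemma increment_law n r B : (n < N)%N -> measurable B ->
  P [set w | B (increment n r w)] = normal_prob 0 (Num.sqrt h) B.
Proof.
move=> nN mB; case: brownian_W => _ _ law _.
have <- : t n.+1 - t n = h by rewrite -mulrBl -natrB// subSnn mul1r.
exact: (law r (t n) (t n.+1) (t_ge0 n) (t_lt n) (t_le nN) B mB).
Qed.

Lemma increment_independent n (A : set Omega) (B : 'I_D -> set R) : (n < N)%N ->
  F (t n) A -> (forall r, measurable (B r)) ->
  P (A `&` \bigcap_r [set w | B r (increment n r w)]) =
  (P A * \prod_(r < D) P [set w | B r (increment n r w)])%E.
Proof.
move=> nN FA mB; case: brownian_W => _ _ _ ind.
exact: (ind (t n) (t n.+1) (t_ge0 n) (t_lt n) (t_le nN) A B FA mB).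
Qed.

Variables (C1 delta : R).
Hypotheses (C10 : 0 <= C1) (hdelta : h + D%:R * threshold <= delta).
Hypothesis step_lipschitz : forall (z1 z2 : 'I_D -> R) y1 x1 y2 x2,
  h + \sum_r `|z1 r| <= delta -> h + \sum_r `|z2 r| <= delta ->
  scheme_step c b (jac L) f g h z1 y1 x1 -> scheme_step c b (jac L) f g h z2 y2 x2 ->
  `|x1 - x2| <= C1 * (`|y1 - y2| + \sum_r `|z1 r - z2 r|).

Let sum_z_le n w : \sum_r `|z n r w| <= D%:R * threshold.
Proof.
rewrite (le_trans (ler_sum _ (fun r _ => norm_truncation_le _)))//.
by rewrite sumr_const card_ord mulr_natl.
Qed.

Let z_small n w : h + \sum_r `|z n r w| <= delta.
Proof. by rewrite (le_trans _ hdelta)// lerD2l; exact: sum_z_le. Qed.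

(* The implicit step has at most one solution, which is a Lipschitz function of
   the current state and of the truncated increments. *)
Lemma scheme_adapted n : (n <= N)%N -> vec_measurable (F (t n)) (y n).
Proof.
elim: n => [_|n IH nN].
  by rewrite t0; case: scheme => -> _ _.
move=> j; apply/(measurable_g_sigma_algebraP _ (F_sigma nN)).
apply: (@vector_lipschitz_measurable _ _ _ _ (g_sigma_algebraType (F (t n.+1)))
  (y n) (z n) _ good C1) => //.
- move=> i; apply/(measurable_g_sigma_algebraP _ (F_sigma nN)) => B mB.
  by apply: (F_mono (leqnSn n) nN); exact: (IH (ltnW nN)).
- move=> r; exact: measurableT_comp measurable_truncation (increment_adapted r nN).
- move=> A Ag; apply: sub_sigma_algebra; exact: sub_not_good.
- move=> w w' gw gw'.
  have := norm_coord_le (y n.+1 w - y n.+1 w') j 0; rewrite !mxE => /le_trans; apply.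
  by apply: step_lipschitz (gw n nN) (gw' n nN); exact: z_small.
Qed.

Lemma measurable_scheme n j : (n <= N)%N -> measurable_fun [set: Omega] (fun w => y n w j 0).
Proof.
by move=> nN _ B mB; rewrite setTI; apply: (F_sub nN); exact: scheme_adapted.
Qed.

Variables (l : 'cV[R]_m -> R) (Phi : 'cV[R]_m -> ('I_D -> R) -> R).
Variables (e : nat) (Cl CPhi K Cm1 Cm2 : R).
Hypotheses (h1 : h <= 1) (Cl0 : 0 <= Cl) (CPhi0 : 0 <= CPhi) (K0 : 0 <= K)
  (Cm10 : 0 <= Cm1) (Cm20 : 0 <= Cm2).
Hypothesis l_lipschitz : forall x1 x2, `|l x1 - l x2| <= Cl * `|x1 - x2|.
Hypothesis Phi_lipschitz : forall y1 z1 y2 z2,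
  (forall r, `|z1 r| <= threshold) -> (forall r, `|z2 r| <= threshold) ->
  `|Phi y1 z1 - Phi y2 z2| <= CPhi * (`|y1 - y2| + \sum_r `|z1 r - z2 r|).
Hypothesis Phi_odd : forall y1 z1, Phi y1 (fun r => - z1 r) = - Phi y1 z1.
Hypothesis Phi_bound : forall y1 z1,
  `|Phi y1 z1| <= K * (Num.sqrt h + \sum_r `|z1 r|) ^+ e.+1.
Hypothesis remainder_bound : forall z1 y1 x1, h + \sum_r `|z1 r| <= delta ->
  scheme_step c b (jac L) f g h z1 y1 x1 ->
  `|l x1 - l y1 - Phi y1 z1| <= K * (Num.sqrt h + \sum_r `|z1 r|) ^+ e.+2.
Hypothesis moment1 : forall n, (n < N)%N ->
  (\int[P]_w ((Num.sqrt h + \sum_r `|increment n r w|) ^+ (e.+1).*2)%:E <=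
   (Cm1 * Num.sqrt h ^+ (e.+1).*2)%:E)%E.
Hypothesis moment2 : forall n, (n < N)%N ->
  (\int[P]_w ((Num.sqrt h + \sum_r `|increment n r w|) ^+ (e.+2).*2)%:E <=
   (Cm2 * Num.sqrt h ^+ (e.+2).*2)%:E)%E.

(** Cut off outside [good], so that the bounds of a step hold for every outcome. *)
Definition drift n w : R := \1_good w * (l (y n w) - l (y 0%N w)).

Let Mt n w : R := \1_good w * Phi (y n w) (fun r => z n r w).

Let Q n w : R := drift n.+1 w - drift n w - Mt n w.

Lemma drift_adapted n : (n <= N)%N ->
  measurable_fun [set: g_sigma_algebraType (F (t n))] (drift n).
Proof.
move=> nN.
have ml k : (k <= n)%N ->
    measurable_fun [set: g_sigma_algebraType (F (t n))] (fun w => l (y k w)).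
  move=> kn; apply: (@vector_lipschitz_measurable _ _ 0 _ (g_sigma_algebraType (F (t n)))
      (y k) (fun=> cst 0) _ setT Cl) => //.
  - move=> i; apply/(measurable_g_sigma_algebraP _ (F_sigma nN)) => B mB.
    by apply: (F_mono kn nN); apply: scheme_adapted => //; exact: leq_trans nN.
  - by move=> A; rewrite setCT subset0 => ->.
  - by move=> w w' _ _; rewrite big_ord0 addr0.
apply: measurable_funM.
  apply: measurable_indic; rewrite -[good]setCK; apply: measurableC.
  by apply: sub_sigma_algebra; exact: sub_not_good.
by apply: measurable_funB; exact: ml.
Qed.

Let indic_le1 w : 0 <= (\1_good w : R) <= 1.
Proof. by rewrite indicE; case: (_ \in _); rewrite /= ?lexx ?ler01. Qed.

Let rho_le n w : Num.sqrt h + \sum_r `|z n r w| <= Num.sqrt h + \sum_r `|increment n r w|.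
Proof. by rewrite lerD2l ler_sum// => r _; exact: norm_truncation_le_norm. Qed.

Let rho_ge0 n w : 0 <= Num.sqrt h + \sum_r `|z n r w|.
Proof. by rewrite addr_ge0 ?sqrtr_ge0 ?sumr_ge0. Qed.

Let Mt_bound n w : `|Mt n w| <= K * (Num.sqrt h + \sum_r `|z n r w|) ^+ e.+1.
Proof.
have /andP[i0 i1] := indic_le1 w.
by rewrite normrM (ger0_norm i0) (le_trans (ler_piMl _ i1))// Phi_bound.
Qed.

Let Q_bound n w : (n < N)%N ->
  `|Q n w| <= K * (Num.sqrt h + \sum_r `|z n r w|) ^+ e.+2.
Proof.
move=> nN; rewrite /Q /drift /Mt indicE.
have [gw|gw] := boolP (w \in good); last first.
  by rewrite !mul0r !subr0 normr0 mulr_ge0// exprn_ge0// rho_ge0.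
rewrite !mul1r opprB addrA subrK; apply: remainder_bound; first exact: z_small.
by move: gw; rewrite inE; exact.
Qed.

Let bmax : R := Num.sqrt h + D%:R * threshold.

Let rho_bmax n w : Num.sqrt h + \sum_r `|z n r w| <= bmax.
Proof. by rewrite lerD2l; exact: sum_z_le. Qed.

Let measurable_Phi n : (n < N)%N ->
  measurable_fun [set: Omega] (fun w => Phi (y n w) (fun r => z n r w)).
Proof.
move=> nN; apply: (@vector_lipschitz_measurable _ _ _ _ _ (y n) (z n) _ setT CPhi) => //.
- by move=> j; apply: measurable_scheme; exact: ltnW.
- move=> r; exact: measurableT_comp measurable_truncation (measurable_increment r nN).
- by move=> A; rewrite setCT subset0 => ->.
- by move=> w w' _ _; apply: Phi_lipschitz => r; exact: norm_truncation_le.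
Qed.

Let bounded_Mt n : (n < N)%N -> bounded_rv (Mt n).
Proof.
move=> nN; split.
  apply: measurable_funM; last exact: measurable_Phi.
  exact: measurable_indic measurable_good.
exists (K * bmax ^+ e.+1) => w; rewrite (le_trans (Mt_bound _ _))// ler_wpM2l//.
by apply: ler_exprn; [exact: rho_ge0|exact: rho_bmax].
Qed.

Let measurable_drift n : (n <= N)%N -> measurable_fun [set: Omega] (drift n).
Proof.
move=> nN _ B mB; rewrite setTI; apply: (F_sub nN).
exact: (measurable_g_sigma_algebraP _ (F_sigma nN)).2 (drift_adapted nN) B mB.
Qed.

Let bounded_Q n : (n < N)%N -> bounded_rv (Q n).
Proof.
move=> nN; split.
  apply: measurable_funB; last by case: (bounded_Mt nN).
  by apply: measurable_funB; apply: measurable_drift => //; exact: ltnW.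
exists (K * bmax ^+ e.+2) => w; rewrite (le_trans (Q_bound _ nN))// ler_wpM2l//.
by apply: ler_exprn; [exact: rho_ge0|exact: rho_bmax].
Qed.

Let driftS n w : drift n.+1 w = drift n w + Mt n w + Q n w.
Proof. by rewrite /Q; ring. Qed.

Let bounded_drift n : (n <= N)%N -> bounded_rv (drift n).
Proof.
elim: n => [_|n IH nN].
  split; first exact: measurable_drift.
  by exists 0 => w; rewrite /drift subrr mulr0 normr0.
have := bounded_rvD (bounded_rvD (IH (ltnW nN)) (bounded_Mt nN)) (bounded_Q nN).
by congr bounded_rv; apply/funext => w; rewrite driftS.
Qed.

(** Both [drift n] and [y n] are known at time [t n], the increments are independent of that past,
    and truncation is odd; so the product is an odd functional of symmetric noise. *)
Lemma martingale_term_centred n : (n < N)%N -> \int[P]_w (drift n w * Mt n w) = 0.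
Proof.
move=> nN; have nN' := ltnW nN.
have [_ [Kv HKv]] := bounded_drift nN'.
pose H (p : Omega * ('I_D -> R)) :=
  drift n p.1 * Phi (y n p.1) (fun r => truncation (p.2 r)).
(* The indicator in [Mt] is dropped because [drift n] already carries it. *)
transitivity (\int[P]_w H (w, fun r => increment n r w)).
  apply: eq_Rintegral => w _; rewrite /H /Mt /drift /= indicE.
  by case: (w \in good); rewrite ?mul1r ?mul0r.
apply: (@odd_expectation_eq0 _ _ _ _ _ (F_sigma nN') P (increment n) H
  (Kv * (K * bmax ^+ e.+1))).
- exact: F_sub.
- by move=> r; exact: measurable_increment.
- by move=> A B FA mB; exact: increment_independent.
- move=> r B mB.
  have mBN : measurable [set x : R | B (- x)].
    rewrite [X in measurable X](_ : _ = (-%R : R -> R) @^-1` B)// -[_ @^-1` _]setTI.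
    exact: oppr_measurable.
  rewrite (increment_law r nN mB) (increment_law r nN mBN).
  by rewrite normal_prob_sym// gt_eqF// sqrtr_gt0.
- apply: measurable_funM.
    apply: measurable_fst_rectangles => B mB.
    exact: (measurable_g_sigma_algebraP _ (F_sigma nN')).2 (drift_adapted nN') B mB.
  apply: (@vector_lipschitz_measurable _ _ _ _
    (g_sigma_algebraType (rectangles (F (t n)))) (fun p => y n p.1)
    (fun r p => truncation (p.2 r)) _ setT CPhi) => //.
  + by move=> j; apply: (measurable_fst_rectangles (U := fun w => y n w j 0));
      exact: scheme_adapted.
  + by move=> r; exact: (measurable_snd_rectangles (F_sigma nN') r measurable_truncation).
  + by move=> A; rewrite setCT subset0 => ->.
  + by move=> w w' _ _; apply: Phi_lipschitz => r; exact: norm_truncation_le.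
- move=> [w x]; rewrite /H normrM ler_pM//= (le_trans (Phi_bound _ _))//.
  have S0 : 0 <= Num.sqrt h + \sum_r `|truncation (x r)|.
    by rewrite addr_ge0 ?sqrtr_ge0 ?sumr_ge0.
  have Sb : Num.sqrt h + \sum_r `|truncation (x r)| <= bmax.
    rewrite lerD2l (le_trans (ler_sum _ (fun r _ => norm_truncation_le _)))//.
    by rewrite sumr_const card_ord mulr_natl.
  by rewrite ler_wpM2l// ler_exprn.
- move=> w x; rewrite /H /= -mulrN -Phi_odd; congr (_ * Phi _ _).
  by apply/funext => r; rewrite truncationN.
Qed.

(** Per step, [Mt] has mean square [O(h ^+ e.+1)] and [Q] has [O(h ^+ e.+2)]; the energy step adds
    [O(h ^+ e.+1)], which is [h] times [O(h ^+ e)], and Gronwall runs over [N%:R * h = T]. *)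
Lemma drift_mean_square :
  \int[P]_w (drift N w ^+ 2) <=
  (2 * (K ^+ 2 * Cm1) + 3 * (K ^+ 2 * Cm2)) * h ^+ e * T * expR T.
Proof.
have sh k : Num.sqrt h ^+ k.*2 = h ^+ k by rewrite -mul2n exprM sqr_sqrtr// ltW.
pose C := (2 * (K ^+ 2 * Cm1) + 3 * (K ^+ 2 * Cm2)) * h ^+ e.
have C0 : 0 <= C.
  rewrite mulr_ge0 ?exprn_ge0 ?(ltW h0)//.
  by rewrite addr_ge0// !mulr_ge0// sqr_ge0.
rewrite -hN -/C.
apply: (@discrete_gronwall R (fun n => \int[P]_w (drift n w ^+ 2)) h C N) => //.
- exact: ltW.
- rewrite (_ : (fun w => _) = cst 0); first by rewrite Rintegral_cst// mul0r.
  by apply/funext => w; rewrite /drift subrr mulr0 expr0n.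
- move=> n nN.
  have bM := bounded_Mt nN; have bQ := bounded_Q nN.
  have := @energy_step R _ _ P (drift n) (Mt n) (Q n) h
    (K ^+ 2 * (Cm1 * h ^+ e.+1)) (K ^+ 2 * (Cm2 * h ^+ e.+1)) h0 h1
    (bounded_drift (ltnW nN)) bM bQ (martingale_term_centred nN).
  have -> : (fun w => (drift n w + Mt n w + Q n w) ^+ 2) = fun w => drift n.+1 w ^+ 2.
    by apply/funext => w; rewrite driftS.
  have rho2 k w : K * (Num.sqrt h + \sum_r `|z n r w|) ^+ k <=
      K * (Num.sqrt h + \sum_r `|increment n r w|) ^+ k.
    by rewrite ler_wpM2l// ler_exprn ?rho_ge0// rho_le.
  move=> H; apply: (le_trans (H _ _ _)).
  + rewrite -sh; apply: (second_moment_le _ _ _ _ (moment1 nN)).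
    * exact: sqrtr_ge0.
    * by case: bM.
    * by move=> r; exact: measurable_increment.
    * by move=> w; rewrite (le_trans (Mt_bound n w)).
  + have -> : K ^+ 2 * (Cm2 * h ^+ e.+1) * h =
        K ^+ 2 * (Cm2 * Num.sqrt h ^+ (e.+2).*2) by rewrite sh (exprSr h e.+1); ring.
    apply: (second_moment_le _ _ _ _ (moment2 nN)).
    * exact: sqrtr_ge0.
    * by case: bQ.
    * by move=> r; exact: measurable_increment.
    * by move=> w; rewrite (le_trans (Q_bound w nN)).
  + by rewrite !mulr_ge0 ?sqr_ge0// exprn_ge0// ltW.
  + rewrite lerD2l le_eqVlt; apply/orP; left; apply/eqP.
    by rewrite /C (exprSr h e); ring.
Qed.

(** Since [good] has full probability, the cut-off can be removed under the integral. *)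
Lemma potential_mean_square :
  (\int[P]_w ((l (y N w) - l (y 0%N w)) ^+ 2)%:E <=
   ((2 * (K ^+ 2 * Cm1) + 3 * (K ^+ 2 * Cm2)) * h ^+ e * T * expR T)%:E)%E.
Proof.
have ml k : (k <= N)%N -> measurable_fun [set: Omega] (fun w => l (y k w)).
  move=> kN; apply: (@vector_lipschitz_measurable _ _ 0 _ _ (y k) (fun=> cst 0)
      _ setT Cl) => //.
  - by move=> i; exact: measurable_scheme.
  - by move=> A; rewrite setCT subset0 => ->.
  - by move=> w w' _ _; rewrite big_ord0 addr0.
have mdl : measurable_fun [set: Omega] (fun w => ((l (y N w) - l (y 0%N w)) ^+ 2)%:E).
  apply/measurable_EFinP; apply: measurable_funX.
  by apply: measurable_funB; exact: ml.
have bN := bounded_drift (leqnn N).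
have bN2 := bounded_rvM bN bN.
rewrite (@ge0_ae_eq_integral _ _ _ P setT _ (fun w => (drift N w ^+ 2)%:E))//.
- have /integrable_fin_num fin := bounded_rv_integrable P bN2.
  by rewrite -[leLHS]fineK ?fin// lee_fin; exact: drift_mean_square.
- by apply/measurable_EFinP; case: bN2.
- by move=> w _; rewrite lee_fin sqr_ge0.
- by move=> w _; rewrite lee_fin sqr_ge0.
- exists (~` good); split.
  + by apply: measurableC; exact: measurable_good.
  + apply: measure_negligible; first by apply: measurableC; exact: measurable_good.
    exact: not_good_negligible.
  + move=> w /= H gw; apply: H => _; rewrite /drift indicE.
    by rewrite mem_set// mul1r.
Qed.

End scheme_paths.

(** * From one component to the whole invariant *)

Section potential_components.
Context {R : realType} {d : measure_display} {Omega : measurableType d}.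
Context {m nu D M : nat}.
Variables (P : probability Omega R) (q : nat) (T : R) (F : R -> set (set Omega)).
Variables (W : 'I_D -> R -> Omega -> R) (Y0 : Omega -> 'cV[R]_m).
Variables (f : 'cV[R]_m -> 'cV[R]_m) (g : 'I_D -> 'cV[R]_m -> 'cV[R]_m).
Variables (L : 'cV[R]_m -> 'cV[R]_nu) (c b : 'I_M -> R).
Hypotheses (T_gt0 : 0 < T) (usual_F : usual_filtration P T F)
  (brownian_W : brownian_motions P T F W) (Y0_F0 : vec_measurable (F 0) Y0)
  (L_C1 : Ck 1 L) (L_invariant : is_invariant L f g)
  (gramL_unit : forall y, jac L y *m (jac L y)^T \in unitmx)
  (gramL_inv_Cb : Ckb 1 (fun y => invmx (jac L y *m (jac L y)^T)))
  (order_q : quadrature_order c b q) (q_gt0 : (0 < q)%N)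
  (f_Cb : Ckb q.+1 f) (g_Cb : forall r, Ckb q.+1 (g r)) (gradL_Cb : Ckb q.+1 (jac L)).

Let differentiable_L x : differentiable L x.
Proof. by have [_ [dL _]] := L_C1. Qed.

Let partial_L i j : (fun x => 'D_(delta_mx j 0) (fun x' => L x' i 0) x) =
  fun x => jac L x i j.
Proof.
by apply/funext => x; rewrite derive_coord; [rewrite [RHS]mxE|exact: differentiable_L].
Qed.

Let component_smooth i j :
  Ckb q.+1 (fun x => 'D_(delta_mx j 0) (fun x' => L x' i 0) x).
Proof. by rewrite partial_L; exact: Ckb_coord. Qed.

Let component_differentiable i x : differentiable (fun x' => L x' i 0) x.
Proof. by apply: differentiable_coord_comp; exact: differentiable_L. Qed.

(** Twice the rate claimed for the root mean square. *)
Definition mean_square_order : nat := if odd q then q.-1 else q.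

(* For odd [q] no cancellation is needed and the centred term is taken to be 0. *)
Lemma component_mean_square : exists2 h0 : R, 0 < h0 &
  forall i : 'I_nu, exists2 K : R, 0 <= K &
    forall (N : nat) (y : nat -> Omega -> 'cV[R]_m), (0 < N)%N -> T / N%:R <= h0 ->
    mavf_scheme P L f g c b W Y0 (T / N%:R) N y ->
    (\int[P]_w ((L (y N w) i 0 - L (y 0%N w) i 0) ^+ 2)%:E <=
     (K * (T / N%:R) ^+ mean_square_order)%:E)%E.
Proof.
have [BJ blJ] := Ckb_bounded_lipschitz gradL_Cb.
have [Bf blf] := Ckb_bounded_lipschitz f_Cb.
have /choice[Bg blg] := fun r => Ckb_bounded_lipschitz (g_Cb r).
have [B' _ HB'] := Ckb_bounded gramL_inv_Cb.
have [C1 [delta [C10 delta0 H1 H2 H3]]] := scheme_step_estimates order_q q_gt0 blJ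
  gramL_unit HB' blf blg (fun y => (L_invariant y).1) (fun r y => (L_invariant y).2 r).
have [h0 /andP[h0_gt0 h01] h0P] := truncation_threshold_small D delta0.
exists h0 => // i.
pose l x := L x i 0.
have [Cl Cl0 HCl] := potential_lipschitz (component_differentiable i) (component_smooth i).
have JE y j : jac L y i j = 'D_(delta_mx j 0) l y.
  by rewrite /l derive_coord; [rewrite [LHS]mxE|exact: differentiable_L].
have [CE CE0 HCE] := scheme_step_expansion order_q (component_differentiable i)
  (component_smooth i) blg JE C10 H1 H2.
have [CB CB0 HCB] := leading_term_bound c b (component_smooth i) blg.
set e := mean_square_order.
have [Cm1 Cm10 HCm1] := @noise_moment_le R D e.+1.
have [Cm2 Cm20 HCm2] := @noise_moment_le R D e.+2.
pose K := CE + CB.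
have K0 : 0 <= K by rewrite addr_ge0.
pose Phi y z := if odd q then 0 else leading_term c b q g l y z.
have S0 (z : 'I_D -> R) : 0 <= \sum_r `|z r| by exact: sumr_ge0.
exists ((2 * (K ^+ 2 * Cm1) + 3 * (K ^+ 2 * Cm2)) * T * expR T).
  rewrite !mulr_ge0 ?expR_ge0 ?(ltW T_gt0)// addr_ge0// !mulr_ge0// sqr_ge0.
move=> N y N0; set h := T / N%:R => hh0 scheme.
have h_gt0 : 0 < h by rewrite divr_gt0// ltr0n.
have h_le1 : h <= 1 by exact: le_trans h01.
have sh_gt0 : 0 < Num.sqrt h by rewrite sqrtr_gt0.
have hN : N%:R * h = T by rewrite mulrC divfK// pnatr_eq0 -lt0n.
have thr0 : 0 <= threshold h by rewrite mulr_ge0 ?sqrtr_ge0.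
have [CP CP0 HCP] := leading_term_lipschitz c b (component_smooth i) blg thr0.
have law n r B := @increment_law _ _ _ _ _ _ _ W h N h_gt0 hN brownian_W n r B.
have minc n r := @measurable_increment _ _ _ _ _ _ F W h N h_gt0 hN usual_F brownian_W n r.
have -> : (2 * (K ^+ 2 * Cm1) + 3 * (K ^+ 2 * Cm2)) * T * expR T * h ^+ e =
    (2 * (K ^+ 2 * Cm1) + 3 * (K ^+ 2 * Cm2)) * h ^+ e * T * expR T by ring.
apply: (@potential_mean_square _ _ _ _ _ _ _ P T F W Y0 f g L c b h N y h_gt0 hN usual_F
  brownian_W Y0_F0 scheme C1 delta C10 _ _ l Phi e Cl CP K Cm1 Cm2) => //.
- exact: h0P.
- by move=> z1 z2 y1 x1 y2 x2; apply: H3; exact: ltW.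
- move=> y1 z1 y2 z2 hz1 hz2; rewrite /Phi; case: ifP => _; last exact: HCP.
  by rewrite subrr normr0 mulr_ge0// addr_ge0.
- move=> y1 z1; rewrite /Phi; case: ifPn => [_|qeven]; first by rewrite oppr0.
  by rewrite leading_termN -signr_odd /= (negbTE qeven) expr1 mulN1r.
- move=> y1 z1; rewrite /Phi /e /mean_square_order; case: ifPn => [_|qeven].
    by rewrite normr0 mulr_ge0// exprn_ge0// addr_ge0// ltW.
  rewrite (le_trans (HCB y1 z1))// ler_pM// ?exprn_ge0 ?lerDr//.
  by rewrite ler_exprn// lerDr ltW.
- move=> z1 y1 x1 hd st; have [|E1 E2] := HCE h z1 y1 x1 _ hd st; first by rewrite h_gt0.
  (* For odd [q], [e.+2 = q.+1] and the crude bound [E2] is the remainder bound; for even [q],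
     [e.+2 = q.+2] and [E1] is used. *)
  rewrite /Phi /e /mean_square_order; case: ifPn => [qodd|qeven].
    rewrite subr0 prednK// (le_trans E2)// ler_wpM2r ?lerDl//.
    by rewrite exprn_ge0// addr_ge0// ltW.
  rewrite (le_trans E1)// ler_wpM2r ?lerDl//.
  by rewrite exprn_ge0// addr_ge0// ltW.
- move=> n nN; apply: HCm1 => // r; first exact: minc.
  by move=> B mB; exact: law.
- move=> n nN; apply: HCm2 => // r; first exact: minc.
  by move=> B mB; exact: law.
Qed.

Lemma measurable_component i n N h y :
  (n <= N)%N -> mavf_scheme P L f g c b W Y0 h N y ->
  measurable_fun [set: Omega] (fun w => L (y n w) i 0).
Proof.
move=> nN [_ my _].
have [Cl Cl0 HCl] := potential_lipschitz (component_differentiable i) (component_smooth i).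
apply: (@vector_lipschitz_measurable _ _ 0 _ _ (y n) (fun=> cst 0) _ setT Cl) => //.
- by move=> j _ B mB; rewrite setTI; exact: my.
- by move=> A; rewrite setCT subset0 => ->.
- by move=> w w' _ _; rewrite big_ord0 addr0; exact: HCl.
Qed.

Lemma invariant_mean_square : exists K h0 : R, [/\ 0 <= K, 0 < h0 &
    forall (N : nat) (y : nat -> Omega -> 'cV[R]_m), (0 < N)%N -> T / N%:R <= h0 ->
    mavf_scheme P L f g c b W Y0 (T / N%:R) N y ->
    ('E_P[fun w => (enorm (L (y N w) - L (y 0%N w)) ^+ 2)%R] <=
     (K * (T / N%:R) ^+ mean_square_order)%:E)%E].
Proof.
have [h0 h0_gt0 H] := component_mean_square.
have /choice[K HK] : forall i : 'I_nu, exists K, 0 <= K /\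
    forall (N : nat) (y : nat -> Omega -> 'cV[R]_m), (0 < N)%N -> T / N%:R <= h0 ->
    mavf_scheme P L f g c b W Y0 (T / N%:R) N y ->
    (\int[P]_w ((L (y N w) i 0 - L (y 0%N w) i 0) ^+ 2)%:E <=
     (K * (T / N%:R) ^+ mean_square_order)%:E)%E.
  by move=> i; have [K K0 HK] := H i; exists K.
exists (\sum_i K i), h0; split => //.
  by apply: sumr_ge0 => i _; case: (HK i).
move=> N y N0 hh0 scheme; rewrite unlock.
have -> : (\int[P]_w ((enorm (L (y N w) - L (y 0%N w)) ^+ 2)%R)%:E =
    \int[P]_w (\sum_(i < nu) ((L (y N w) i 0 - L (y 0%N w) i 0) ^+ 2)%:E))%E.
  apply: eq_integral => w _; rewrite sumEFin; congr EFin.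
  rewrite sqr_sqrtr; last by apply: sumr_ge0 => i _; rewrite sqr_ge0.
  by apply: eq_bigr => i _; rewrite !mxE.
rewrite ge0_integral_sum//.
- rewrite mulr_suml -sumEFin; apply: lee_sum => i _.
  by case: (HK i) => _; apply.
- move=> i; apply/measurable_EFinP; apply: measurable_funX.
  by apply: measurable_funB; apply: measurable_component scheme.
- by move=> i w _; rewrite lee_fin sqr_ge0.
Qed.

End potential_components.

Theorem theorem4p7 (R : realType) (d : measure_display)
    (Omega : measurableType d) (P : probability Omega R)
    (m nu D M q : nat) (T : R) (F : R -> set (set Omega))
    (W : 'I_D -> R -> Omega -> R) (Y0 : Omega -> 'cV[R]_m)
    (f : 'cV[R]_m -> 'cV[R]_m) (g : 'I_D -> 'cV[R]_m -> 'cV[R]_m)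
    (L : 'cV[R]_m -> 'cV[R]_nu) (c b : 'I_M -> R)
    (T_gt0 : 0 < T)
    (usual_F : usual_filtration P T F)
    (brownian_W : brownian_motions P T F W)
    (Y0_F0 : vec_measurable (F 0) Y0)
    (Y0_L2 : ('E_P[fun w => (enorm (Y0 w) ^+ 2)%R] < +oo)%E)
    (lipschitz_drift : lipschitz (ito_drift f g))
    (lipschitz_diffusion : forall r, lipschitz (g r))
    (unique_sol : has_unique_solution P T F W f g Y0)
    (L_C1 : Ck 1 L)
    (L_invariant : is_invariant L f g)
    (gramL_unit : forall y, jac L y *m (jac L y)^T \in unitmx)
    (gramL_inv_Cb : Ckb 1 (fun y => invmx (jac L y *m (jac L y)^T)))
    (order_q : quadrature_order c b q)
    (q_ge2 : (2 <= q)%N)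
    (f_Cb : Ckb q.+1 f)
    (g_Cb : forall r, Ckb q.+1 (g r))
    (gradL_Cb : Ckb q.+1 (jac L)) :
  exists K h0 : R, 0 < h0 /\
    forall (N : nat) (y : nat -> Omega -> 'cV[R]_m), (0 < N)%N ->
      let h := T / N%:R in
      h <= h0 ->
      mavf_scheme P L f g c b W Y0 h N y ->
      ('E_P[fun w => (enorm (L (y N w) - L (y 0%N w)) ^+ 2)%R] `^ (2^-1) <=
       (K * h `^ (if odd q then (q%:R - 1) / 2 else q%:R / 2))%:E)%E.
Proof.
have [K [h0 [K0 h0_gt0 HK]]] := invariant_mean_square T_gt0 usual_F brownian_W Y0_F0
  L_C1 L_invariant gramL_unit gramL_inv_Cb order_q (ltnW q_ge2) f_Cb g_Cb gradL_Cb.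
exists (K `^ 2^-1), h0; split => // N y N0 h hh0 scheme.
have h_ge0 : 0 <= h by rewrite divr_ge0// ltW.
have := HK N y N0 hh0 scheme; rewrite -/h => HE.
have E0 : (0 <= 'E_P[fun w => (enorm (L (y N w) - L (y 0%N w)) ^+ 2)%R])%E.
  by apply: expectation_ge0 => w; rewrite sqr_ge0.
have -> : (if odd q then (q%:R - 1) / 2 else q%:R / 2) =
    (mean_square_order q)%:R / 2 :> R.
  rewrite /mean_square_order; case: ifP => // _.
  by rewrite -[in LHS](prednK (ltnW q_ge2)) -natr1 addrK.
(* Both sides become powers of exponent 1/2, which are monotone on nonnegative extended reals. *)
rewrite powRrM powR_mulrn// -powRM// ?exprn_ge0// -poweR_EFin.
apply: gt0_ler_poweR => //.
- by rewrite in_itv /= E0 leey.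
- by rewrite in_itv /= lee_fin mulr_ge0 ?exprn_ge0//= leey.
Qed.
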